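(* Let $0<q<1$. If $(\pi,F)$ is a commutator representation of the $3D$-calculus or of the $4D_\pm$-calculus on $SU_q(2)$ such that all operators $\mathrm{d}_{\pi,F}(x)$, $x\in\mathcal{A}=\mathcal{O}(SU_q(2))$, are bounded, then $\mathrm{d}_{\pi,F}(x)=0$ for all $x\in\mathcal{A}$.
   Context: **The algebra.** $0<q<1$; $\mathcal{A}=\mathcal{O}(SU_q(2))$ is the Hopf $\ast$-algebra generated by $a,b,c,d$ with $ab=qba$, $ac=qca$, $bd=qdb$, $cd=qdc$, $bc=cb$, $ad-qbc=da-q^{-1}bc=1$; $\Delta(a)=a\otimes a+b\otimes c$, $\Delta(b)=a\otimes b+b\otimes d$, $\Delta(c)=c\otimes a+d\otimes c$, $\Delta(d)=c\otimes b+d\otimes d$; $\varepsilon(a)=\varepsilon(d)=1$, $\varepsilon(b)=\varepsilon(c)=0$; $S(a)=d$, $S(d)=a$, $S(b)=-q^{-1}b$, $S(c)=-qc$; $a^*=d$, $b^*=-qc$, $c^*=-q^{-1}b$, $d^*=a$. Sweedler notation: $\Delta(x)=x_{(1)}\otimes x_{(2)}$. The counit $\varepsilon$ must not be confused with the sign $\epsilon$ below. **Differential calculi.** A first order differential calculus (FODC) over a unital $\ast$-algebra $\mathcal{A}$ is an $\mathcal{A}$-bimodule $\Gamma$ with a linear map $\mathrm{d}:\mathcal{A}\to\Gamma$ such that $\mathrm{d}(xy)=x\,\mathrm{d}y+\mathrm{d}x\,y$ and $\Gamma=\mathrm{Lin}\{x\,\mathrm{d}y\,z\}$. It is a $\ast$-FODC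 if it is equipped with an (antilinear) involution with $(x\,\mathrm{d}y\,z)^*=z^*\mathrm{d}(y^* )x^*$. A homomorphism of FODC $\Gamma_1\to\Gamma_2$ is a linear map $\rho$ with $\rho(x\,\mathrm{d}_1y\,z)=x\,\mathrm{d}_2y\,z$; for $\ast$-FODC one also requires $\rho(\omega^* )=\rho(\omega)^*$. An FODC over a Hopf algebra is left-covariant if there is a linear map $\varphi:\Gamma\to\mathcal{A}\otimes\Gamma$ with $\varphi(x\,\mathrm{d}y)=\Delta(x)(\mathrm{id}\otimes\mathrm{d})\Delta(y)$. Put $\omega_\Gamma(x)=S(x_{(1)})\mathrm{d}x_{(2)}$ and $\mathcal{R}_\Gamma=\{x\in\ker\varepsilon:\omega_\Gamma(x)=0\}$; this is a right ideal which determines $\Gamma$ up to isomorphism, and every right ideal contained in $\ker\varepsilon$ occurs. The $3D$-calculus is the left-covariant $\ast$-FODC over $\mathcal{A}$ whose right ideal is generated by $b^2$, $c^2$, $bc$, $(a-1)b$, $(a-1)c$, $q^2a+d-(q^2+1)$. The $4D_\pm$-calculus $\Gamma_\pm$ (with $\epsilon=+1$ for $4D_+$, $\epsilon=-1$ for $4D_-$) is the left-covariant $\ast$-FODC over $\mathcal{A}$ whose right ideal is generated by $b^2$, $c^2$, $b(a-d)$, $c(a-d)$, $a^2+q^2d^2-(1+q^2)(ad+q^{-1}bc)$, $z_\pm b$, $z_\pm c$, $z_\pm(a-d)$, $z_\pm(q^2a+d-(q^2+1))$, where $z_\pm:=q^2a+d-\epsilon(q^3+q^{-1})$. **Commutator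 representations.** Let $\pi$ be a $\ast$-representation of $\mathcal{A}$ by bounded operators on a Hilbert space and $F$ a symmetric operator on that space with dense domain $\mathcal{D}(F)$; let $\mathcal{D}_F\subseteq\mathcal{D}(F)$ be a dense linear subspace with $\pi(\mathcal{A})\mathcal{D}_F\subseteq\mathcal{D}(F)$. $\Gamma_{\pi,F}$ is the span of the operators $\pi(x)(F\pi(y)-\pi(y)F)\pi(z)\lceil\mathcal{D}_F$ (restriction to $\mathcal{D}_F$), with bimodule structure given by multiplication by $\pi(x)$ from left and right, differential $\mathrm{d}_{\pi,F}(x)=(\mathrm{i}F\pi(x)-\pi(x)\mathrm{i}F)\lceil\mathcal{D}_F$ and involution $\big(\sum_j\pi(x_j)(F\pi(y_j)-\pi(y_j)F)\pi(z_j)\lceil\mathcal{D}_F\big)^*=\sum_j\pi(z_j^* )(\pi(y_j^* )F-F\pi(y_j^* ))\pi(x_j^* )\lceil\mathcal{D}_F$; it is a $\ast$-FODC. $(\pi,F)$ is a commutator representation of a $\ast$-FODC $\Gamma$ if there is a $\ast$-FODC homomorphism $\rho:\Gamma\to\Gamma_{\pi,F}$. *)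

(* Defs.v *)
From HB Require Import structures.
From mathcomp Require Import all_boot all_order all_algebra.
From mathcomp Require Import all_classical all_reals all_analysis.
From mathcomp.real_closed Require Import complex.
Set Implicit Arguments.
Unset Strict Implicit.
Unset Printing Implicit Defensive.
Import Order.TTheory GRing.Theory Num.Theory.
Import numFieldNormedType.Exports.
Local Open Scope classical_set_scope.
Local Open Scope ring_scope.
Local Open Scope quotient_scope.

(* The tensor product of two K-modules, as the module presented by the        *)
(* symbols v (x) w and the bilinearity relations.                             *)
Section Tensor.
Variables (K : comNzRingType) (V W : lmodType K).

Inductive tterm :=
| TZero
| TPure of V & W
| TAdd of tterm & tterm
| TScale of K & tterm.

Inductive tcong : tterm -> tterm -> Prop :=
| tcong_refl t : tcong t t
| tcong_sym s t : tcong s t -> tcong t s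
| tcong_trans s t u : tcong s t -> tcong t u -> tcong s u
| tcong_add s s' t t' :
    tcong s s' -> tcong t t' -> tcong (TAdd s t) (TAdd s' t')
| tcong_scale k t t' : tcong t t' -> tcong (TScale k t) (TScale k t')
| tcong_addA s t u : tcong (TAdd s (TAdd t u)) (TAdd (TAdd s t) u)
| tcong_addC s t : tcong (TAdd s t) (TAdd t s)
| tcong_add0 t : tcong (TAdd TZero t) t
| tcong_scale0 t : tcong (TScale 0 t) TZero
| tcong_scale1 t : tcong (TScale 1 t) t
| tcong_scaleA k l t : tcong (TScale k (TScale l t)) (TScale (k * l) t)
| tcong_scaleDl k l t :
    tcong (TScale (k + l) t) (TAdd (TScale k t) (TScale l t))
| tcong_scaleDr k s t :
    tcong (TScale k (TAdd s t)) (TAdd (TScale k s) (TScale k t))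
| tcong_pureDl v v' w : tcong (TPure (v + v') w) (TAdd (TPure v w) (TPure v' w))
| tcong_pureDr v w w' : tcong (TPure v (w + w')) (TAdd (TPure v w) (TPure v w'))
| tcong_pureZl k v w : tcong (TPure (k *: v) w) (TScale k (TPure v w))
| tcong_pureZr k v w : tcong (TPure v (k *: w)) (TScale k (TPure v w)).

HB.instance Definition _ := gen_eqMixin tterm.
HB.instance Definition _ := gen_choiceMixin tterm.

Definition tcongb (s t : tterm) : bool := `[< tcong s t >].

Lemma tcongb_refl : reflexive tcongb.
Proof. by move=> t; apply/asboolP/tcong_refl. Qed.
Lemma tcongb_sym : symmetric tcongb.
Proof. by move=> s t; apply/asboolP/asboolP; apply: tcong_sym. Qed.
Lemma tcongb_trans : transitive tcongb.
Proof. by move=> t s u /asboolP st /asboolP tu; apply/asboolP/(tcong_trans st). Qed.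

Canonical tcong_equiv := EquivRel tcongb tcongb_refl tcongb_sym tcongb_trans.

Definition tensor := {eq_quot tcong_equiv}.
HB.instance Definition _ := EqQuotient.on tensor.
HB.instance Definition _ := Choice.on tensor.

Lemma tpiP s t : \pi_tensor s = \pi_tensor t <-> tcong s t.
Proof. by split => [/eqmodP/asboolP|st] //; apply/eqmodP/asboolP. Qed.

Lemma trepr s : tcong (repr (\pi_tensor s)) s.
Proof. by apply/tpiP; rewrite reprK. Qed.

Definition tzero : tensor := \pi_tensor TZero.
Definition tadd (s t : tensor) : tensor := \pi_tensor (TAdd (repr s) (repr t)).
Definition tscale (k : K) (t : tensor) : tensor := \pi_tensor (TScale k (repr t)).
Definition tpure (v : V) (w : W) : tensor := \pi_tensor (TPure v w).

Lemma tadd_pi s t : tadd (\pi_tensor s) (\pi_tensor t) = \pi_tensor (TAdd s t).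
Proof. by apply/tpiP; apply: tcong_add; apply: trepr. Qed.
Lemma tscale_pi k t : tscale k (\pi_tensor t) = \pi_tensor (TScale k t).
Proof. by apply/tpiP; apply: tcong_scale; apply: trepr. Qed.

Fact taddA : associative tadd.
Proof.
elim/quotW=> s; elim/quotW=> t; elim/quotW=> u.
by rewrite (tadd_pi t u) (tadd_pi s t) !tadd_pi; apply/tpiP; apply: tcong_addA.
Qed.
Fact taddC : commutative tadd.
Proof. by elim/quotW=> s; elim/quotW=> t; rewrite !tadd_pi; apply/tpiP; apply: tcong_addC. Qed.
Fact tadd0 : left_id tzero tadd.
Proof. by elim/quotW=> s; rewrite tadd_pi; apply/tpiP; apply: tcong_add0. Qed.
Fact taddN : left_inverse tzero (tscale (-1)) tadd.
Proof.
elim/quotW=> s; rewrite tscale_pi tadd_pi; apply/tpiP.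
apply: (tcong_trans (tcong_add (tcong_refl _) (tcong_sym (tcong_scale1 s)))).
apply: (tcong_trans (tcong_sym (tcong_scaleDl _ _ _))).
by rewrite addNr; apply: tcong_scale0.
Qed.
HB.instance Definition _ := GRing.isZmodule.Build tensor taddA taddC tadd0 taddN.

Fact tscaleA k l t : tscale k (tscale l t) = tscale (k * l) t.
Proof. by elim/quotW: t => t; rewrite (tscale_pi l t) !tscale_pi; apply/tpiP; apply: tcong_scaleA. Qed.
Fact tscale1 : left_id 1 tscale.
Proof. by elim/quotW=> t; rewrite tscale_pi; apply/tpiP; apply: tcong_scale1. Qed.
Fact tscaleDr : right_distributive tscale +%R.
Proof.
move=> k; elim/quotW=> s; elim/quotW=> t.
rewrite /GRing.add /= (tadd_pi s t) (tscale_pi k s) (tscale_pi k t) tscale_pi.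
by rewrite tadd_pi; apply/tpiP; apply: tcong_scaleDr.
Qed.
Fact tscaleDl t : {morph tscale^~ t : k l / k + l}.
Proof.
move=> k l; elim/quotW: t => t.
rewrite [RHS]/GRing.add /= (tscale_pi k t) (tscale_pi l t) tscale_pi tadd_pi.
by apply/tpiP; apply: tcong_scaleDl.
Qed.
HB.instance Definition _ :=
  GRing.Zmodule_isLmodule.Build K tensor tscaleA tscale1 tscaleDr tscaleDl.

Lemma pi_taddE s t : \pi_tensor (TAdd s t) = \pi_tensor s + \pi_tensor t.
Proof. by rewrite -tadd_pi. Qed.
Lemma pi_tscaleE k t : \pi_tensor (TScale k t) = k *: \pi_tensor t.
Proof. by rewrite -tscale_pi. Qed.

Fact tpure_bilinear : bilinear_for *:%R *:%R tpure.
Proof.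
split=> [w k v v'|v k w w']; rewrite /= /tpure -pi_tscaleE -pi_taddE.
  apply/tpiP; apply: tcong_trans (tcong_pureDl _ _ _) _.
  by apply: tcong_add (tcong_refl _); apply: tcong_pureZl.
apply/tpiP; apply: tcong_trans (tcong_pureDr _ _ _) _.
by apply: tcong_add (tcong_refl _); apply: tcong_pureZr.
Qed.
HB.instance Definition _ :=
  bilinear_isBilinear.Build K V W tensor *:%R *:%R tpure tpure_bilinear.

Lemma tpureDl w : {morph tpure^~ w : v v' / v + v'}.
Proof. by move=> v v'; rewrite linearDl. Qed.
Lemma tpureDr v : {morph tpure v : w w' / w + w'}.
Proof. by move=> w w'; rewrite linearDr. Qed.
Lemma tpureZl k v w : tpure (k *: v) w = k *: tpure v w.
Proof. by rewrite linearZl_LR. Qed.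
Lemma tpureZr k v w : tpure v (k *: w) = k *: tpure v w.
Proof. by rewrite linearZr_LR. Qed.

Lemma tensor_ind (P : tensor -> Prop) :
  P 0 -> (forall v w, P (tpure v w)) -> (forall s t, P s -> P t -> P (s + t)) ->
  forall t, P t.
Proof.
move=> P0 Pp PD.
suff H t k : P (k *: \pi_tensor t) by elim/quotW=> t; rewrite -[\pi_tensor t]scale1r.
elim: t k => [|v w|s IHs t IHt|l t IHt] k.
- by rewrite (_ : \pi_tensor TZero = 0) // scaler0.
- by rewrite -[\pi_tensor (TPure v w)]/(tpure v w) -linearZl_LR.
- by rewrite pi_taddE scalerDr; apply: PD.
- by rewrite pi_tscaleE scalerA.
Qed.

(* tlift f is the linear map sending v (x) w to f v w; it is meaningful only  *)
(* when f is bilinear, see tlift_pure and tlift_linear.                       *)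
Fixpoint teval (U : lmodType K) (f : V -> W -> U) (t : tterm) : U :=
  match t with
  | TZero => 0
  | TPure v w => f v w
  | TAdd s t => teval f s + teval f t
  | TScale k t => k *: teval f t
  end.

Definition tlift (U : lmodType K) (f : V -> W -> U) (t : tensor) : U :=
  teval f (repr t).

Section Lift.
Variables (U : lmodType K) (f : V -> W -> U).
Hypothesis fbil : bilinear_for *:%R *:%R f.

Lemma teval_cong s t : tcong s t -> teval f s = teval f t.
Proof.
case: fbil => fl fr.
elim=> //= {s t}.
- by move=> s t u _ -> _ ->.
- by move=> s s' t t' _ -> _ ->.
- by move=> k t t' _ ->.
- by move=> *; rewrite addrA.
- by move=> *; rewrite addrC.
- by move=> *; rewrite add0r.
- by move=> *; rewrite scale0r.
- by move=> *; rewrite scale1r.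
- by move=> *; rewrite scalerA.
- by move=> *; rewrite scalerDl.
- by move=> *; rewrite scalerDr.
- by move=> v v' w; have := fl w 1 v v'; rewrite /= !scale1r.
- by move=> v w w'; have := fr v 1 w w'; rewrite /= !scale1r.
- move=> k v w; have := fl w k v 0; rewrite /= addr0 => ->.
  have := fl w (-1) 0 0; rewrite /= scaler0 addr0 scaleN1r addNr => ->.
  by rewrite addr0.
- move=> k v w; have := fr v k w 0; rewrite /= addr0 => ->.
  have := fr v (-1) 0 0; rewrite /= scaler0 addr0 scaleN1r addNr => ->.
  by rewrite addr0.
Qed.

Lemma tlift_pi t : tlift f (\pi_tensor t) = teval f t.
Proof. exact: teval_cong (trepr t). Qed.

Lemma tlift_pure v w : tlift f (tpure v w) = f v w.
Proof. by rewrite tlift_pi. Qed.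

Lemma tlift_linear : linear (tlift f).
Proof.
move=> k; elim/quotW=> s; elim/quotW=> t.
by rewrite -pi_tscaleE -pi_taddE !tlift_pi.
Qed.

End Lift.
End Tensor.

(* The bilinear map (V1 (x) W1) x (V2 (x) W2) -> V3 (x) W3 determined by      *)
(* (v1 (x) w1, v2 (x) w2) |-> f v1 v2 (x) g w1 w2, for f and g bilinear.      *)
Section TensorMap.
Variables (K : comNzRingType) (V1 V2 V3 W1 W2 W3 : lmodType K).
Variables (f : V1 -> V2 -> V3) (g : W1 -> W2 -> W3).

Definition tmap2 (s : tensor V1 W1) (t : tensor V2 W2) : tensor V3 W3 :=
  tlift (fun v1 w1 => tlift (fun v2 w2 => tpure (f v1 v2) (g w1 w2)) t) s.

Hypothesis fbil : bilinear_for *:%R *:%R f.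
Hypothesis gbil : bilinear_for *:%R *:%R g.

Lemma tmap2_bilinear_r v1 w1 :
  bilinear_for *:%R *:%R (fun v2 w2 => tpure (f v1 v2) (g w1 w2)).
Proof.
split=> [w k v v'|v k w w'] /=.
  by rewrite (fbil.2 v1 k v v') linearPl.
by rewrite (gbil.2 w1 k w w') linearPr.
Qed.

Lemma tmap2_bilinear_l t : bilinear_for *:%R *:%R
  (fun v1 w1 => tlift (fun v2 w2 => tpure (f v1 v2) (g w1 w2)) t).
Proof.
have L v w := tlift_linear (tmap2_bilinear_r v w).
have L0 v w : tlift (fun v2 w2 => tpure (f v v2) (g w w2)) 0 = 0.
  by have := L v w (-1) 0 0; rewrite scaler0 addr0 scaleN1r addNr.
have LD v w s s' : tlift (fun v2 w2 => tpure (f v v2) (g w w2)) (s + s') =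
  tlift (fun v2 w2 => tpure (f v v2) (g w w2)) s +
  tlift (fun v2 w2 => tpure (f v v2) (g w w2)) s'.
  by have := L v w 1 s s'; rewrite !scale1r.
split=> [w k v v'|v k w w'] /=; elim/tensor_ind: t => [|x y|s t IHs IHt].
- by rewrite !L0 scaler0 addr0.
- by rewrite !(tlift_pure (tmap2_bilinear_r _ _)) (fbil.1 x k v v') linearPl.
- by rewrite !LD IHs IHt scalerDr addrACA.
- by rewrite !L0 scaler0 addr0.
- by rewrite !(tlift_pure (tmap2_bilinear_r _ _)) (gbil.1 y k w w') linearPr.
- by rewrite !LD IHs IHt scalerDr addrACA.
Qed.

Lemma tmap2_pure v1 w1 v2 w2 :
  tmap2 (tpure v1 w1) (tpure v2 w2) = tpure (f v1 v2) (g w1 w2).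
Proof.
by rewrite /tmap2 (tlift_pure (tmap2_bilinear_l _)) (tlift_pure (tmap2_bilinear_r _ _)).
Qed.

Lemma tmap2_bilinear : bilinear_for *:%R *:%R tmap2.
Proof.
split=> [t k s s'|s k t t'] /=.
  exact: (tlift_linear (tmap2_bilinear_l _)).
elim/tensor_ind: s => [|x y|s s' IHs IHs'].
- have L0 u : tmap2 0 u = 0.
    have := tlift_linear (tmap2_bilinear_l u) (-1) 0 0.
    by rewrite scaler0 addr0 scaleN1r addNr.
  by rewrite !L0 scaler0 addr0.
- rewrite /tmap2 !(tlift_pure (tmap2_bilinear_l _)).
  exact: (tlift_linear (tmap2_bilinear_r _ _)).
- have LD u : tmap2 (s + s') u = tmap2 s u + tmap2 s' u.
    by have := tlift_linear (tmap2_bilinear_l u) 1 s s'; rewrite !scale1r.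
  by rewrite !LD IHs IHs' scalerDr addrACA.
Qed.

End TensorMap.

Lemma mulr_bilinear (K : comNzRingType) (A : algType K) :
  bilinear_for *:%R *:%R (@GRing.mul A).
Proof.
split=> [z k x y|z k x y] /=; first by rewrite mulrDl scalerAl.
by rewrite mulrDr scalerAr.
Qed.

HB.mixin Record isStarAlgebra (R : realType) A of GRing.Algebra R[i] A := {
  star : A -> A;
  starK : involutive star;
  starP : forall (k : R[i]) (x y : A), star (k *: x + y) = k^* *: star x + star y;
  starM : forall x y : A, star (x * y) = star y * star x
}.

#[short(type="starAlgType")]
HB.structure Definition StarAlgebra (R : realType) :=
  {A of GRing.Algebra R[i] A & isStarAlgebra R A}.

(* O(SU_q(2)), the complex algebra presented by a, b, c, d and the defining   *)
(* relations: terms modulo the least congruence that contains the relations   *)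
(* and the axioms of unital associative algebras.                             *)
Inductive suq2_gen := Ga | Gb | Gc | Gd.

Inductive aterm (K : Type) :=
| ACst of K
| AGen of suq2_gen
| AAdd of aterm K & aterm K
| AMul of aterm K & aterm K.
Arguments AGen {K}.

HB.instance Definition _ K := gen_eqMixin (aterm K).
HB.instance Definition _ K := gen_choiceMixin (aterm K).

Declare Scope aterm_scope.
Notation "x + y" := (AAdd x y) : aterm_scope.
Notation "x * y" := (AMul x y) : aterm_scope.

Section Presentation.
Variables (R : realType) (q : R).
Local Notation p := (q%:C)%C.
Local Notation term := (aterm R[i]).
Local Notation cst := (@ACst R[i]).
Local Notation a := (AGen Ga).
Local Notation b := (AGen Gb).
Local Notation c := (AGen Gc).
Local Notation d := (AGen Gd).
Local Open Scope aterm_scope.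

Inductive suq2_rel : term -> term -> Prop :=
| suq2_ab : suq2_rel (a * b) (cst p * (b * a))
| suq2_ac : suq2_rel (a * c) (cst p * (c * a))
| suq2_bd : suq2_rel (b * d) (cst p * (d * b))
| suq2_cd : suq2_rel (c * d) (cst p * (d * c))
| suq2_bc : suq2_rel (b * c) (c * b)
| suq2_ad : suq2_rel (a * d + cst (- p)%R * (b * c)) (cst 1%R)
| suq2_da : suq2_rel (d * a + cst (- p^-1)%R * (b * c)) (cst 1%R).

Inductive acong : term -> term -> Prop :=
| acong_rel s t : suq2_rel s t -> acong s t
| acong_refl t : acong t t
| acong_sym s t : acong s t -> acong t s
| acong_trans s t u : acong s t -> acong t u -> acong s u
| acong_add s s' t t' : acong s s' -> acong t t' -> acong (s + t) (s' + t')
| acong_mul s s' t t' : acong s s' -> acong t t' -> acong (s * t) (s' * t')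
| acong_addA s t u : acong (s + (t + u)) ((s + t) + u)
| acong_addC s t : acong (s + t) (t + s)
| acong_add0 t : acong (cst 0%R + t) t
| acong_mulA s t u : acong (s * (t * u)) ((s * t) * u)
| acong_mul0 t : acong (cst 0%R * t) (cst 0%R)
| acong_mul1 t : acong (cst 1%R * t) t
| acong_mulDl s t u : acong ((s + t) * u) (s * u + t * u)
| acong_mulDr s t u : acong (s * (t + u)) (s * t + s * u)
| acong_cstD k l : acong (cst (k + l)%R) (cst k + cst l)
| acong_cstM k l : acong (cst (k * l)%R) (cst k * cst l)
| acong_cstC k t : acong (cst k * t) (t * cst k).

Definition acongb (s t : term) : bool := `[< acong s t >].

Lemma acongb_refl : reflexive acongb.
Proof. by move=> t; apply/asboolP/acong_refl. Qed.
Lemma acongb_sym : symmetric acongb.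
Proof. by move=> s t; apply/asboolP/asboolP; apply: acong_sym. Qed.
Lemma acongb_trans : transitive acongb.
Proof. by move=> t s u /asboolP st /asboolP tu; apply/asboolP/(acong_trans st). Qed.

Canonical acong_equiv := EquivRel acongb acongb_refl acongb_sym acongb_trans.

(* Evaluation of terms in a (possibly not yet packaged) unital algebra, given *)
(* by its scalars k |-> k * 1, its product and the images of the generators.  *)
Section Eval.
Variables (U : zmodType) (kst : R[i] -> U) (mul : U -> U -> U).
Variable g : suq2_gen -> U.

Fixpoint aeval (t : term) : U :=
  match t with
  | ACst k => kst k
  | AGen x => g x
  | AAdd s t => (aeval s + aeval t)%R
  | AMul s t => mul (aeval s) (aeval t)
  end.

Record is_model := IsModel {
  model_cstD : {morph kst : k l / (k + l)%R};
  model_cstM : forall k l, kst (k * l)%R = mul (kst k) (kst l);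
  model_cstC : forall k u, mul (kst k) u = mul u (kst k);
  model_mulA : associative mul;
  model_mul1 : left_id (kst 1%R) mul;
  model_mulDl : left_distributive mul +%R;
  model_mulDr : right_distributive mul +%R;
  model_rel : forall s t, suq2_rel s t -> aeval s = aeval t
}.

Lemma aeval_cong s t : is_model -> acong s t -> aeval s = aeval t.
Proof.
case=> cD cM cC mA m1 mDl mDr mrel.
have c0 : kst 0%R = 0%R.
  by apply: (addrI (kst 0%R)); rewrite -cD !addr0.
have m0 u : mul 0%R u = 0%R.
  by apply: (addrI (mul 0%R u)); rewrite -mDl !addr0.
elim=> //= {s t}.
- by move=> s t u _ -> _ ->.
- by move=> s s' t t' _ -> _ ->.
- by move=> s s' t t' _ -> _ ->.
- by move=> *; rewrite addrA.
- by move=> *; rewrite addrC.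
- by move=> *; rewrite c0 add0r.
- by move=> *; rewrite c0 m0.
Qed.
End Eval.
End Presentation.

Definition suq2 (R : realType) (q : R) (hq : 0 < q < 1) := {eq_quot acong_equiv q}.

Section SUq2Algebra.
Variables (R : realType) (q : R) (hq : 0 < q < 1).
Local Notation A := (suq2 hq).
Local Notation term := (aterm R[i]).
Local Notation p := (q%:C)%C.

HB.instance Definition _ := EqQuotient.on A.
HB.instance Definition _ := Choice.on A.

Lemma suq2_piP s t : \pi_A s = \pi_A t <-> acong q s t.
Proof. by split => [/eqmodP/asboolP|st] //; apply/eqmodP/asboolP. Qed.

Let arepr s : acong q (repr (\pi_A s)) s.
Proof. by apply/suq2_piP; rewrite reprK. Qed.

Definition suq2_add (x y : A) : A := \pi_A (AAdd (repr x) (repr y)).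
Definition suq2_mul (x y : A) : A := \pi_A (AMul (repr x) (repr y)).
Definition suq2_cst (k : R[i]) : A := \pi_A (ACst k).

Let addpi s t : suq2_add (\pi_A s) (\pi_A t) = \pi_A (AAdd s t).
Proof. by apply/suq2_piP; apply: acong_add; apply: arepr. Qed.
Let mulpi s t : suq2_mul (\pi_A s) (\pi_A t) = \pi_A (AMul s t).
Proof. by apply/suq2_piP; apply: acong_mul; apply: arepr. Qed.

Fact suq2_addA : associative suq2_add.
Proof.
elim/quotW=> s; elim/quotW=> t; elim/quotW=> u.
by rewrite (addpi t u) (addpi s t) !addpi; apply/suq2_piP; apply: acong_addA.
Qed.
Fact suq2_addC : commutative suq2_add.
Proof. by elim/quotW=> s; elim/quotW=> t; rewrite !addpi; apply/suq2_piP; apply: acong_addC. Qed.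
Fact suq2_add0 : left_id (suq2_cst 0) suq2_add.
Proof. by elim/quotW=> s; rewrite addpi; apply/suq2_piP; apply: acong_add0. Qed.
Fact suq2_addN : left_inverse (suq2_cst 0) (suq2_mul (suq2_cst (-1))) suq2_add.
Proof.
elim/quotW=> s; rewrite mulpi addpi; apply/suq2_piP.
apply: (acong_trans (acong_add (acong_refl _ _) (acong_sym (acong_mul1 _ s)))).
apply: (acong_trans (acong_sym (acong_mulDl _ _ _ _))).
apply: (acong_trans _ (acong_mul0 _ s)).
apply: acong_mul (acong_refl _ _).
by apply: (acong_trans (acong_sym (acong_cstD _ _ _))); rewrite addNr; apply: acong_refl.
Qed.
HB.instance Definition _ :=
  GRing.isZmodule.Build A suq2_addA suq2_addC suq2_add0 suq2_addN.

Lemma suq2_piD s t : \pi_A (AAdd s t) = \pi_A s + \pi_A t.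
Proof. by rewrite -addpi. Qed.

Definition counit_gen (x : suq2_gen) : R[i] :=
  match x with Ga | Gd => 1 | Gb | Gc => 0 end.

Lemma counit_model : is_model q id *%R counit_gen.
Proof.
split=> //=; [exact: mulrC|exact: mulrA|exact: mul1r|exact: mulrDl|exact: mulrDr|].
by move=> s t [] /=; rewrite ?(mulr0, mul0r, mul1r, mulr1, addr0).
Qed.

Fact suq2_mulA : associative suq2_mul.
Proof.
elim/quotW=> s; elim/quotW=> t; elim/quotW=> u.
by rewrite (mulpi t u) (mulpi s t) !mulpi; apply/suq2_piP; apply: acong_mulA.
Qed.
Fact suq2_mul1l : left_id (suq2_cst 1) suq2_mul.
Proof. by elim/quotW=> s; rewrite mulpi; apply/suq2_piP; apply: acong_mul1. Qed.
Fact suq2_mulC k x : suq2_mul (suq2_cst k) x = suq2_mul x (suq2_cst k).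
Proof. by elim/quotW: x => s; rewrite !mulpi; apply/suq2_piP; apply: acong_cstC. Qed.
Fact suq2_mul1r : right_id (suq2_cst 1) suq2_mul.
Proof. by move=> x; rewrite -suq2_mulC suq2_mul1l. Qed.
Fact suq2_mulDl : left_distributive suq2_mul +%R.
Proof.
elim/quotW=> s; elim/quotW=> t; elim/quotW=> u.
by rewrite -suq2_piD (mulpi s u) (mulpi t u) mulpi -suq2_piD; apply/suq2_piP; apply: acong_mulDl.
Qed.
Fact suq2_mulDr : right_distributive suq2_mul +%R.
Proof.
elim/quotW=> s; elim/quotW=> t; elim/quotW=> u.
by rewrite -suq2_piD (mulpi s t) (mulpi s u) mulpi -suq2_piD; apply/suq2_piP; apply: acong_mulDr.
Qed.
Fact suq2_1neq0 : suq2_cst 1 != 0 :> A.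
Proof.
apply/eqP=> /suq2_piP /(aeval_cong counit_model) /= /eqP.
by rewrite oner_eq0.
Qed.
HB.instance Definition _ := GRing.Zmodule_isNzRing.Build A
  suq2_mulA suq2_mul1l suq2_mul1r suq2_mulDl suq2_mulDr suq2_1neq0.

Lemma suq2_piM s t : \pi_A (AMul s t) = \pi_A s * \pi_A t.
Proof. by rewrite -mulpi. Qed.

Lemma suq2_piC k : \pi_A (ACst k) = suq2_cst k.
Proof. by []. Qed.

Fact suq2_cstD k l : suq2_cst (k + l) = suq2_cst k + suq2_cst l.
Proof. by rewrite -suq2_piD; apply/suq2_piP; apply: acong_cstD. Qed.
Fact suq2_cstM k l : suq2_cst (k * l) = suq2_cst k * suq2_cst l.
Proof. by rewrite -suq2_piM; apply/suq2_piP; apply: acong_cstM. Qed.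

Definition suq2_scale (k : R[i]) (x : A) : A := suq2_cst k * x.

Fact suq2_scaleA k l x : suq2_scale k (suq2_scale l x) = suq2_scale (k * l) x.
Proof. by rewrite /suq2_scale mulrA suq2_cstM. Qed.
Fact suq2_scale1 : left_id 1 suq2_scale.
Proof. exact: mul1r. Qed.
Fact suq2_scaleDr : right_distributive suq2_scale +%R.
Proof. by move=> k x y; apply: mulrDr. Qed.
Fact suq2_scaleDl x : {morph suq2_scale^~ x : k l / k + l}.
Proof. by move=> k l; rewrite /suq2_scale suq2_cstD mulrDl. Qed.
HB.instance Definition _ := GRing.Zmodule_isLmodule.Build R[i] A
  suq2_scaleA suq2_scale1 suq2_scaleDr suq2_scaleDl.

Fact suq2_scaleAl k (x y : A) : k *: (x * y) = k *: x * y.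
Proof. exact: mulrA. Qed.
HB.instance Definition _ := GRing.Lmodule_isLalgebra.Build R[i] A suq2_scaleAl.

Fact suq2_scaleAr k (x y : A) : k *: (x * y) = x * (k *: y).
Proof. 
rewrite -[k *: (x * y)]/(suq2_cst k * (x * y)) -[k *: y]/(suq2_cst k * y).
by rewrite !mulrA; congr (_ * y); apply: suq2_mulC.
Qed.
HB.instance Definition _ := GRing.Lalgebra_isAlgebra.Build R[i] A suq2_scaleAr.

End SUq2Algebra.

Section Lift.
Variables (R : realType) (q : R) (hq : 0 < q < 1).
Local Notation A := (suq2 hq).

(* The map out of O(SU_q(2)) determined by the images of the generators; it   *)
(* is meaningful only when these satisfy the defining relations (is_model).   *)
Definition suq2_lift (U : zmodType) (kst : R[i] -> U) (mul : U -> U -> U)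
    (g : suq2_gen -> U) (x : A) : U :=
  aeval kst mul g (repr x).

Definition suq2_of_gen (x : suq2_gen) : A := \pi_A (AGen x).

Lemma suq2_ind (P : A -> Prop) :
  (forall k, P k%:A) -> (forall x, P (suq2_of_gen x)) ->
  (forall x y, P x -> P y -> P (x + y)) ->
  (forall x y, P x -> P y -> P (x * y)) -> forall x, P x.
Proof.
move=> Pc Pg PD PM; elim/quotW; elim=> [k|x|s Ps t Pt|s Ps t Pt].
- by have := Pc k; rewrite /GRing.scale /= /suq2_scale mulr1.
- exact: Pg.
- by rewrite suq2_piD; apply: PD.
- by rewrite suq2_piM; apply: PM.
Qed.

Section Model.
Variables (U : zmodType) (kst : R[i] -> U) (mul : U -> U -> U).
Variable g : suq2_gen -> U.
Hypothesis mg : is_model q kst mul g.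
Local Notation lift := (suq2_lift kst mul g).

Lemma suq2_lift_pi t : lift (\pi_A t) = aeval kst mul g t.
Proof. by apply: (aeval_cong mg); apply/(suq2_piP hq); rewrite reprK. Qed.

Lemma suq2_lift_gen x : lift (suq2_of_gen x) = g x.
Proof. exact: suq2_lift_pi. Qed.

Lemma suq2_liftD : {morph lift : x y / x + y}.
Proof. by move=> x y; rewrite /GRing.add /= suq2_lift_pi. Qed.

Lemma suq2_liftM x y : lift (x * y) = mul (lift x) (lift y).
Proof. by rewrite /GRing.mul /= suq2_lift_pi. Qed.

Lemma suq2_liftZ k x : lift (k *: x) = mul (kst k) (lift x).
Proof.
by rewrite -[k *: x]/(suq2_cst hq k * x) suq2_liftM suq2_lift_pi.
Qed.

Lemma suq2_lift1 : lift 1 = kst 1.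
Proof. by rewrite -[1]/(suq2_cst hq 1) suq2_lift_pi. Qed.
End Model.
End Lift.
Arguments suq2_lift_gen {R q hq U kst mul g}.
Arguments suq2_lift1 {R q hq U kst mul g}.

Section Hopf.
Variables (R : realType) (q : R) (hq : 0 < q < 1).
Local Notation A := (suq2 hq).
Local Notation p := (q%:C)%C.
Local Notation a := (suq2_of_gen hq Ga).
Local Notation b := (suq2_of_gen hq Gb).
Local Notation c := (suq2_of_gen hq Gc).
Local Notation d := (suq2_of_gen hq Gd).

Lemma qC_neq0 : p != 0.
Proof. by case/andP: hq => q0 _; rewrite eq_complex /= eqxx andbT gt_eqF. Qed.

Lemma qC_conj : p^* = p.
Proof. exact: conjc_real. Qed.

Let rel s t : suq2_rel q s t -> \pi_A s = \pi_A t.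
Proof. by move=> st; apply/eqmodP/asboolP/acong_rel. Qed.
Let ev t : \pi_A t = aeval (fun k => k%:A) *%R (suq2_of_gen hq) t.
Proof.
elim: t => [k|x|s Ps t Pt|s Ps t Pt] //=.
- by rewrite /GRing.scale /= /suq2_scale mulr1.
- by rewrite -Ps -Pt suq2_piD.
- by rewrite -Ps -Pt suq2_piM.
Qed.

Lemma suq2_abE : a * b = p *: (b * a).
Proof. by have := rel (suq2_ab q); rewrite !ev /= -scalerAl mul1r. Qed.
Lemma suq2_acE : a * c = p *: (c * a).
Proof. by have := rel (suq2_ac q); rewrite !ev /= -scalerAl mul1r. Qed.
Lemma suq2_bdE : b * d = p *: (d * b).
Proof. by have := rel (suq2_bd q); rewrite !ev /= -scalerAl mul1r. Qed.
Lemma suq2_cdE : c * d = p *: (d * c).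
Proof. by have := rel (suq2_cd q); rewrite !ev /= -scalerAl mul1r. Qed.
Lemma suq2_bcE : b * c = c * b.
Proof. by have := rel (suq2_bc q); rewrite !ev. Qed.
Lemma suq2_adE : a * d = 1 + p *: (b * c).
Proof.
have := rel (suq2_ad q); rewrite !ev /= scale1r -scalerAl mul1r scaleNr.
by move/eqP; rewrite subr_eq => /eqP.
Qed.
Lemma suq2_daE : d * a = 1 + p^-1 *: (b * c).
Proof.
have := rel (suq2_da q); rewrite !ev /= scale1r -scalerAl mul1r scaleNr.
by move/eqP; rewrite subr_eq => /eqP.
Qed.

Definition counit : A -> R[i] := suq2_lift id *%R (@counit_gen R).

Definition antipode_gen (x : suq2_gen) : A :=
  match x with Ga => d | Gb => - p^-1 *: b | Gc => - p *: c | Gd => a end.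

Definition antipode : A -> A :=
  suq2_lift (fun k => k%:A) (fun x y => y * x) antipode_gen.

Definition star_gen (x : suq2_gen) : A :=
  match x with Ga => d | Gb => - p *: c | Gc => - p^-1 *: b | Gd => a end.

Definition suq2_star : A -> A :=
  suq2_lift (fun k => (k^*)%:A) (fun x y => y * x) star_gen.

Definition comult_gen (x : suq2_gen) : tensor A A :=
  match x with
  | Ga => tpure a a + tpure b c
  | Gb => tpure a b + tpure b d
  | Gc => tpure c a + tpure d c
  | Gd => tpure c b + tpure d d
  end.

Definition tmul : tensor A A -> tensor A A -> tensor A A := tmap2 *%R *%R.

Definition comult : A -> tensor A A :=
  suq2_lift (fun k => k *: tpure 1 1) tmul comult_gen.


Lemma antipode_model :
  is_model q (fun k : R[i] => k%:A : A) (fun x y => y * x) antipode_gen.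
Proof.
have p0 := qC_neq0.
split=> //=.
- by move=> k l; rewrite scalerDl.
- by move=> k l; rewrite -scalerAl mul1r scalerA mulrC.
- by move=> k u; rewrite -scalerAl -scalerAr mul1r mulr1.
- by move=> x y z; rewrite mulrA.
- by move=> x; rewrite scale1r mulr1.
- by move=> x y z; rewrite mulrDr.
- by move=> x y z; rewrite mulrDl.
move=> s t [] /=; rewrite !(scaleNr, scalerN, mulrN, mulNr, opprK, =^~scalerAl, =^~scalerAr, scalerA, scale1r, mul1r, mulr1).
- by rewrite suq2_bdE scalerA mulVf // divff.
- by rewrite suq2_cdE scalerA.
- by rewrite suq2_abE scalerA mulVf // divff.
- by rewrite suq2_acE scalerA.
- by rewrite mulVf // divff // suq2_bcE.
- by rewrite suq2_adE mulfK // suq2_bcE addrK.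
- by rewrite suq2_daE mulVf // mul1r suq2_bcE addrK.
Qed.

Lemma star_model :
  is_model q (fun k : R[i] => (k^*)%:A : A) (fun x y => y * x) star_gen.
Proof.
have p0 := qC_neq0.
split=> //=.
- by move=> k l; rewrite rmorphD scalerDl.
- by move=> k l; rewrite -scalerAl mul1r scalerA mulrC rmorphM.
- by move=> k u; rewrite -scalerAl -scalerAr mul1r mulr1.
- by move=> x y z; rewrite mulrA.
- by move=> x; rewrite rmorph1 scale1r mulr1.
- by move=> x y z; rewrite mulrDr.
- by move=> x y z; rewrite mulrDl.
move=> s t [] /=; rewrite ?rmorph1 ?rmorphN ?fmorphV /= ?qC_conj.
all: rewrite !(scaleNr, scalerN, mulrN, mulNr, opprK, =^~scalerAl, =^~scalerAr, scalerA, scale1r, mul1r, mulr1).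
- by rewrite suq2_cdE scalerA.
- by rewrite suq2_bdE scalerA mulVf // divff.
- by rewrite suq2_acE scalerA.
- by rewrite suq2_abE scalerA mulVf // divff.
- by rewrite mulVf // divff // suq2_bcE.
- by rewrite suq2_adE divff // mul1r addrK.
- by rewrite suq2_daE mulfVK // addrK.
Qed.

Fact suq2_starP (k : R[i]) (x y : A) :
  suq2_star (k *: x + y) = k^* *: suq2_star x + suq2_star y.
Proof.
by rewrite /suq2_star (suq2_liftD star_model) (suq2_liftZ star_model) -scalerAr mulr1.
Qed.

Fact suq2_starM (x y : A) : suq2_star (x * y) = suq2_star y * suq2_star x.
Proof. by rewrite /suq2_star (suq2_liftM star_model). Qed.

Fact suq2_starK : involutive suq2_star.
Proof.
have p0 := qC_neq0.
have sZ k x : suq2_star (k *: x) = k^* *: suq2_star x.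
  by rewrite /suq2_star (suq2_liftZ star_model) -scalerAr mulr1.
elim/suq2_ind=> [k|x|x y Hx Hy|x y Hx Hy].
- have s1 : suq2_star 1 = 1 by rewrite /suq2_star (suq2_lift1 star_model) rmorph1 scale1r.
  by rewrite !sZ !s1 conjCK.
- rewrite /suq2_star (suq2_lift_gen star_model).
  case: x => /=; rewrite -/suq2_star ?sZ /suq2_star ?(suq2_lift_gen star_model) //=.
  + by rewrite rmorphN /= qC_conj scalerA mulrNN divff // scale1r.
  + by rewrite rmorphN fmorphV /= qC_conj scalerA mulrNN mulVf // scale1r.
- by rewrite /suq2_star !(suq2_liftD star_model) -/suq2_star Hx Hy.
- by rewrite !suq2_starM Hx Hy.
Qed.

HB.instance Definition _ :=
  isStarAlgebra.Build R A suq2_starK suq2_starP suq2_starM.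

Lemma tmul_bilinear : bilinear_for *:%R *:%R tmul.
Proof. exact: tmap2_bilinear (mulr_bilinear A) (mulr_bilinear A). Qed.

Lemma tmul_pure x y x' y' :
  tmul (tpure x y) (tpure x' y') = tpure (x * x') (y * y').
Proof. exact: tmap2_pure (mulr_bilinear A) (mulr_bilinear A) _ _ _ _. Qed.

Lemma tmulDl : left_distributive tmul +%R.
Proof. by move=> s t u; have := tmul_bilinear.1 u 1 s t; rewrite /= !scale1r. Qed.
Lemma tmulDr : right_distributive tmul +%R.
Proof. by move=> s t u; have := tmul_bilinear.2 s 1 t u; rewrite /= !scale1r. Qed.
Lemma tmul0l s : tmul 0 s = 0.
Proof. by apply: (addrI (tmul 0 s)); rewrite -tmulDl !addr0. Qed.
Lemma tmul0r s : tmul s 0 = 0.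
Proof. by apply: (addrI (tmul s 0)); rewrite -tmulDr !addr0. Qed.
Lemma tmulZl k s t : tmul (k *: s) t = k *: tmul s t.
Proof. by have := tmul_bilinear.1 t k s 0; rewrite /= !addr0 tmul0l addr0. Qed.
Lemma tmulZr k s t : tmul s (k *: t) = k *: tmul s t.
Proof. by have := tmul_bilinear.2 s k t 0; rewrite /= !addr0 tmul0r addr0. Qed.
Lemma tmul1l : left_id (tpure 1 1) tmul.
Proof.
elim/tensor_ind=> [|x y|s t Hs Ht]; first exact: tmul0r.
  by rewrite tmul_pure !mul1r.
by rewrite tmulDr Hs Ht.
Qed.
Lemma tmul1r : right_id (tpure 1 1) tmul.
Proof.
elim/tensor_ind=> [|x y|s t Hs Ht]; first exact: tmul0l.
  by rewrite tmul_pure !mulr1.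
by rewrite tmulDl Hs Ht.
Qed.
Lemma tmulA : associative tmul.
Proof.
move=> s t u; elim/tensor_ind: s => [|x y|s s' Hs Hs']; first by rewrite !tmul0l.
  elim/tensor_ind: t => [|x' y'|t t' Ht Ht']; first by rewrite !(tmul0l, tmul0r).
    elim/tensor_ind: u => [|x'' y''|u u' Hu Hu']; first by rewrite !tmul0r.
      by rewrite !tmul_pure !mulrA.
    by rewrite !tmulDr Hu Hu'.
  by rewrite !(tmulDr, tmulDl) Ht Ht'.
by rewrite !tmulDl Hs Hs'.
Qed.

Let ac1 (U : zmodType) (x y z w v : U) :
  x + (y + z) + (w + v) = x + z + (y + w + v).
Proof. by rewrite !addrA (addrAC x y z). Qed.
Let ac2 (U : zmodType) (x y z w v u : U) :
  x + (y + z) + (w + v + u) = x + (w + z) + (y + v + u).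
Proof. by rewrite (AC (1*2*3) (1*(4*3)*(2*5*6))). Qed.
Let ac3 (U : zmodType) (m o x y k n l : U) :
  m + (o + x + (y + k)) + (n + l) + (- m + (- x - k) + (- y - n - l)) = o.
Proof.
rewrite -!opprD; apply/eqP; rewrite subr_eq; apply/eqP.
by rewrite (AC (1*(2*2)*2) (2*((1*(3*5))*(4*6*7)))).
Qed.
Let ac4 (U : zmodType) (m n o x y k l : U) :
  m + n + (o + x + (y + k) + l) + (- m + (- x - n) + (- y - k - l)) = o.
Proof.
rewrite -!opprD; apply/eqP; rewrite subr_eq; apply/eqP.
by rewrite (AC (2*(2*2*1)) (3*((1*(4*2))*(5*6*7)))).
Qed.

Lemma comult_model : is_model q (fun k => k *: tpure 1 1) tmul comult_gen.
Proof.
have p0 := qC_neq0.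
split=> //=.
- by move=> k l; rewrite scalerDl.
- by move=> k l; rewrite tmulZl tmulZr scalerA tmul_pure !mulr1.
- by move=> k u; rewrite tmulZl tmulZr tmul1l tmul1r.
- exact: tmulA.
- by move=> u; rewrite scale1r tmul1l.
- exact: tmulDl.
- exact: tmulDr.
move=> s t [] /=.
all: rewrite ?tmulZl ?tmul1l !(tmulDl, tmulDr) !tmul_pure.
all: rewrite ?(suq2_abE, suq2_acE, suq2_bdE, suq2_cdE, suq2_adE, suq2_daE, esym suq2_bcE).
all: rewrite ?(tpureDl, tpureDr, tpureZl, tpureZr) ?scalerDr ?scalerA.
all: rewrite ?mulNr ?mulVf ?divff // ?scaleNr ?scale1r ?scalerA.
- exact: ac1.
- exact: ac1.
- exact: ac1.
- exact: ac1.
- exact: ac2.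
- exact: ac3.
- exact: ac4.
Qed.

Lemma counitM x y : counit (x * y) = counit x * counit y.
Proof. exact: suq2_liftM (counit_model q) x y. Qed.
Lemma counit_linear : linear_for *%R counit.
Proof.
move=> k x y.
by rewrite /counit (suq2_liftD (counit_model q)) (suq2_liftZ (counit_model q)).
Qed.
Lemma counit1 : counit 1 = 1.
Proof. by rewrite /counit (suq2_lift1 (counit_model q)). Qed.
Lemma counitE x : counit (suq2_of_gen hq x) = counit_gen R x.
Proof. by rewrite /counit (suq2_lift_gen (counit_model q)). Qed.

Lemma antipodeM x y : antipode (x * y) = antipode y * antipode x.
Proof. by rewrite /antipode (suq2_liftM antipode_model). Qed.
Lemma antipode_linear : linear antipode.
Proof.
move=> k x y.
by rewrite /antipode (suq2_liftD antipode_model) (suq2_liftZ antipode_model) -scalerAr mulr1.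
Qed.
Lemma antipode1 : antipode 1 = 1.
Proof. by rewrite /antipode (suq2_lift1 antipode_model) scale1r. Qed.
Lemma antipodeE x : antipode (suq2_of_gen hq x) = antipode_gen x.
Proof. by rewrite /antipode (suq2_lift_gen antipode_model). Qed.

Lemma starE x : star (suq2_of_gen hq x) = star_gen x.
Proof. by rewrite /star /= /suq2_star (suq2_lift_gen star_model). Qed.

Lemma comultM x y : comult (x * y) = tmul (comult x) (comult y).
Proof. by rewrite /comult (suq2_liftM comult_model). Qed.
Lemma comult_linear : linear comult.
Proof.
move=> k x y.
by rewrite /comult (suq2_liftD comult_model) (suq2_liftZ comult_model) tmulZl tmul1l.
Qed.
Lemma comult1 : comult 1 = tpure 1 1.
Proof. by rewrite /comult (suq2_lift1 comult_model) scale1r. Qed.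
Lemma comultE x : comult (suq2_of_gen hq x) = comult_gen x.
Proof. by rewrite /comult (suq2_lift_gen comult_model). Qed.

End Hopf.

Record fodc (K : comNzRingType) (A : algType K) := Fodc {
  fodc_car :> lmodType K;
  lact : {bilinear A -> fodc_car -> fodc_car};
  ract : {bilinear fodc_car -> A -> fodc_car};
  fdiff : {linear A -> fodc_car};
  lact1 : forall w, lact 1 w = w;
  lactM : forall x y w, lact (x * y) w = lact x (lact y w);
  ract1 : forall w, ract w 1 = w;
  ractM : forall w x y, ract w (x * y) = ract (ract w x) y;
  lractA : forall x w y, ract (lact x w) y = lact x (ract w y);
  fdiffM : forall x y, fdiff (x * y) = lact x (fdiff y) + ract (fdiff x) y;
  fodc_span : forall w, exists s : seq (A * A * A),
    w = \sum_(t <- s) ract (lact t.1.1 (fdiff t.1.2)) t.2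
}.

Arguments lact {K A}.
Arguments ract {K A}.
Arguments fdiff {K A}.

(* x dy z *)
Definition fform (K : comNzRingType) (A : algType K) (G : fodc A) (x y z : A) : G :=
  ract G (lact G x (fdiff G y)) z.

Record star_fodc (R : realType) (A : starAlgType R) := StarFodc {
  star_fodc_car :> fodc A;
  fstar : star_fodc_car -> star_fodc_car;
  fstarK : involutive fstar;
  fstarP : forall (k : R[i]) u v, fstar (k *: u + v) = k^* *: fstar u + fstar v;
  fstarE : forall x y z,
    fstar (fform _ x y z) = fform star_fodc_car (star z) (star y) (star x)
}.

Definition star_fodc_hom (R : realType) (A : starAlgType R)
    (G1 G2 : star_fodc A) (rho : {linear G1 -> G2}) : Prop :=
  (forall x y z, rho (fform G1 x y z) = fform G2 x y z)
  /\ (forall w, rho (fstar w) = fstar (rho w)).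

Definition right_ideal (A : pzRingType) (I : set A) : Prop :=
  [/\ I 0, forall x y, I x -> I y -> I (x + y) & forall x y, I x -> I (x * y)].

Definition right_ideal_gen (A : pzRingType) (G : set A) : set A :=
  smallest (@right_ideal A) G.

Section Covariance.
Variables (R : realType) (q : R) (hq : 0 < q < 1).
Local Notation A := (suq2 hq).

Definition left_covariant (G : fodc A) : Prop :=
  exists phi : {linear G -> tensor A G}, forall x y,
    phi (lact G x (fdiff G y)) =
    tmap2 *%R (lact G) (comult x)
      (tlift (fun y1 y2 => tpure y1 (fdiff G y2)) (comult y)).

(* omega x = S(x_(1)) d x_(2) *)
Definition omega (G : fodc A) (x : A) : G :=
  tlift (fun x1 x2 => lact G (antipode x1) (fdiff G x2)) (comult x).

Definition fodc_ideal (G : fodc A) : set A :=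
  [set x | counit x = 0 /\ omega G x = 0].

Local Notation p := (q%:C)%C.
Local Notation a := (suq2_of_gen hq Ga).
Local Notation b := (suq2_of_gen hq Gb).
Local Notation c := (suq2_of_gen hq Gc).
Local Notation d := (suq2_of_gen hq Gd).

Definition gens_3D : set A := [set`
  [:: b ^+ 2; c ^+ 2; b * c; (a - 1) * b; (a - 1) * c;
      p ^+ 2 *: a + d - (p ^+ 2 + 1)%:A]].

Definition z_4D (eps : R) : A :=
  p ^+ 2 *: a + d - ((eps%:C)%C * (p ^+ 3 + p^-1))%:A.

Definition gens_4D (eps : R) : set A := [set`
  [:: b ^+ 2; c ^+ 2; b * (a - d); c * (a - d);
      a ^+ 2 + p ^+ 2 *: d ^+ 2 - (1 + p ^+ 2) *: (a * d + p^-1 *: (b * c));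
      z_4D eps * b; z_4D eps * c; z_4D eps * (a - d);
      z_4D eps * (p ^+ 2 *: a + d - (p ^+ 2 + 1)%:A)]].

Definition is_3D_calculus (G : star_fodc A) : Prop :=
  left_covariant G /\ fodc_ideal G = right_ideal_gen gens_3D.

(* eps = 1 for 4D_+ and eps = -1 for 4D_- *)
Definition is_4D_calculus (eps : R) (G : star_fodc A) : Prop :=
  left_covariant G /\ fodc_ideal G = right_ideal_gen (gens_4D eps).

End Covariance.

HB.mixin Record CompleteNormedModule_isHilbert (R : realType) H
    of CompleteNormedModule R[i] H := {
  inner : {dot H for @Num.conj R[i]};
  inner_norm : forall u : H, `|u| ^+ 2 = inner u u
}.

#[short(type="hilbertType")]
HB.structure Definition Hilbert (R : realType) :=
  {H of CompleteNormedModule R[i] H & CompleteNormedModule_isHilbert R H}.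

Record star_rep (R : realType) (A : starAlgType R) (H : hilbertType R) := StarRep {
  rep :> A -> {linear H -> H};
  rep_continuous : forall x, continuous (rep x);
  repP : forall (k : R[i]) x y v, rep (k *: x + y) v = k *: rep x v + rep y v;
  rep1 : forall v, rep 1 v = v;
  repM : forall x y v, rep (x * y) v = rep x (rep y v);
  rep_star : forall x u v, inner (rep x u) v = inner u (rep (star x) v)
}.

Definition linear_subspace (K : pzRingType) (V : lmodType K) (D : set V) : Prop :=
  D 0 /\ forall k u v, D u -> D v -> D (k *: u + v).

(* A partially defined operator is a total function together with its domain; *)
(* its values outside the domain are never used.                              *)
Record symmetric_op (R : realType) (H : hilbertType R) := SymmetricOp {
  op_fun :> H -> H;
  dom : set H;
  dom_subspace : linear_subspace dom;
  dom_dense : dense dom;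
  op_linear : forall k u v, dom u -> dom v -> op_fun (k *: u + v) = k *: op_fun u + op_fun v;
  op_symmetric : forall u v, dom u -> dom v -> inner (op_fun u) v = inner u (op_fun v)
}.

(* core is the dense subspace D_F *)
Record comm_pair (R : realType) (A : starAlgType R) (H : hilbertType R) := CommPair {
  cp_rep : star_rep A H;
  cp_op : symmetric_op H;
  core : set H;
  core_subspace : linear_subspace core;
  core_dense : dense core;
  core_sub : core `<=` dom cp_op;
  rep_core : forall x v, core v -> dom cp_op (cp_rep x v)
}.

Section CommutatorCalculus.
Variables (R : realType) (A : starAlgType R) (H : hilbertType R).
Variable P : comm_pair A H.
Local Notation C := R[i].
Local Notation pi := (cp_rep P).
Local Notation F := (cp_op P).
Local Notation D := (core P).

Definition on_core (T : H -> H) : H -> H := patch (fun=> 0) D T.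

(* pi(x) (F pi(y) - pi(y) F) pi(z), before restriction to the core *)
Definition comm_op (t : A * A * A) (v : H) : H :=
  let: (x, y, z) := t in
  pi x (F (pi y (pi z v)) - pi y (F (pi z v))).

Definition comm_sum (s : seq (A * A * A)) : H -> H :=
  on_core (fun v => \sum_(t <- s) comm_op t v).

(* Scalars are absorbed in pi(x), so that the linear span consists of the     *)
(* finite sums.                                                               *)
Definition comm_span : {pred (H -> H)} :=
  fun T => `[< exists s, T = comm_sum s >].

Let ext (s : seq (A * A * A)) (v : H) : H := \sum_(t <- s) comm_op t v.

Definition good (v : H) : Prop := forall x, dom F (pi x v).

Lemma good_core v : D v -> good v.
Proof. by move=> Dv x; apply: rep_core. Qed.
Lemma good_rep x v : good v -> good (pi x v).
Proof. by move=> gv y; rewrite -repM. Qed.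
Lemma goodP k u v : good u -> good v -> good (k *: u + v).
Proof. by move=> gu gv x; rewrite linearP; apply: (dom_subspace F).2. Qed.

Lemma opP0 : F 0 = 0.
Proof.
have := op_linear (s := F) (-1) (dom_subspace F).1 (dom_subspace F).1.
by rewrite scaler0 addr0 scaleN1r addNr.
Qed.

Lemma comm_opP t k u v : good u -> good v ->
  comm_op t (k *: u + v) = k *: comm_op t u + comm_op t v.
Proof.
case: t => [[x y] z] gu gv /=.
have gz : forall w, good w -> good (pi z w) by move=> w; apply: good_rep.
rewrite (linearP (pi z)) (linearP (pi y)).
rewrite (op_linear k (gz _ gu y) (gz _ gv y)) (op_linear k (gu z) (gv z)).
by rewrite (linearP (pi y)) -(linearP (pi x)) scalerBr opprD addrACA.
Qed.

Lemma ext_linear s k u v : good u -> good v -> ext s (k *: u + v) = k *: ext s u + ext s v.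
Proof.
move=> gu gv; rewrite /ext scaler_sumr -big_split /=.
by apply: eq_bigr => t _; apply: comm_opP.
Qed.

Definition comm_adj (t : A * A * A) : A * A * A :=
  let: (x, y, z) := t in (star z, star y, star x).

Lemma comm_adjK : involutive comm_adj.
Proof. by case=> [[x y] z] /=; rewrite !starK. Qed.

Let innerNl (u v : H) : inner (- u) v = - inner u v. Proof. exact: linearNl. Qed.
Let innerNr (u v : H) : inner u (- v) = - inner u v. Proof. exact: linearNr. Qed.
Let innerDl (u u' v : H) : inner (u + u') v = inner u v + inner u' v.
Proof. exact: linearDl. Qed.
Let innerDr (u v v' : H) : inner u (v + v') = inner u v + inner u v'.
Proof. exact: linearDr. Qed.
Let innerZl k (u v : H) : inner (k *: u) v = k * inner u v.
Proof. exact: linearZl_LR. Qed.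
Let innerZr k (u v : H) : inner u (k *: v) = k^* * inner u v.
Proof. exact: linearZr_LR. Qed.
Let inner0l (v : H) : inner 0 v = 0. Proof. exact: linear0l. Qed.
Let inner0r (u : H) : inner u 0 = 0. Proof. exact: linear0r. Qed.

Lemma comm_op_adj t u v : good u -> good v ->
  inner (comm_op t u) v = - inner u (comm_op (comm_adj t) v).
Proof.
case: t => [[x y] z] gu gv /=.
have gz w : good w -> good (pi z w) by apply: good_rep.
have gx w : good w -> good (pi (star x) w) by apply: good_rep.
rewrite rep_star innerDl innerNl op_symmetric; [|exact: gz|exact: gv].
rewrite !rep_star op_symmetric; [|exact: gu|exact: gx].
by rewrite !rep_star (linearB (pi (star z))) innerDr innerNr opprB.
Qed.

Lemma ext_adj s u v : good u -> good v ->
  inner (ext s u) v = - inner u (ext (map comm_adj s) v).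
Proof.
move=> gu gv; rewrite /ext big_map; elim: s => [|t s IH].
  by rewrite !big_nil inner0l inner0r oppr0.
by rewrite !big_cons innerDl innerDr opprD IH comm_op_adj.
Qed.

Lemma core_inner0 (w : H) : (forall u, D u -> inner u w = 0) -> w = 0.
Proof.
move=> h; apply/eqP; case: (eqVneq w 0) => // w0; exfalso.
have nw : 0 < `|w| by rewrite normr_gt0.
have [u []] := @core_dense _ _ _ P (ball w `|w|) (ex_intro _ w (ballxx w nw)) (ball_open w `|w|).
rewrite -ball_normE /= => ltw Du.
have wu0 : inner w u = 0.
  transitivity ((-1) ^+ false * (inner u w)^*); first exact: hermitian_subproof.
  by rewrite h // conjC0 mulr0.
have : `|w - u| ^+ 2 < `|w| ^+ 2 by rewrite ltr_pXn2r ?nnegrE.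
rewrite !inner_norm innerDl !innerDr !innerNl !innerNr (h u Du) wu0.
rewrite oppr0 !addr0 !add0r opprK -subr_gt0 opprD addrA subrr add0r oppr_gt0.
by rewrite -inner_norm => /lt_geF; rewrite exprn_ge0.
Qed.

(* A combination of commutators vanishing on the core vanishes on pi(A) core. *)
Lemma ext_core0 s : (forall v, D v -> ext s v = 0) -> forall v, good v -> ext s v = 0.
Proof.
have step r : (forall v, D v -> ext r v = 0) ->
    forall v, good v -> ext (map comm_adj r) v = 0.
  move=> h v gv; apply: core_inner0 => u Du.
  by apply/eqP; rewrite -oppr_eq0 -ext_adj ?h ?inner0l //; apply: good_core.
move=> h v gv; rewrite -(mapK comm_adjK s); apply: (step _ _ v gv) => u Du.
by apply: (step _ h); apply: good_core.
Qed.

Lemma on_core_in (T : H -> H) v : D v -> on_core T v = T v.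
Proof. by move=> Dv; rewrite /on_core patchT // inE. Qed.
Lemma on_coreN (T : H -> H) v : ~ D v -> on_core T v = 0.
Proof. by move=> Dv; rewrite /on_core patchN // notin_setE. Qed.
Lemma on_core_ext (T T' : H -> H) :
  (forall v, D v -> T v = T' v) -> on_core T = on_core T'.
Proof.
move=> h; apply/funext => v; have [Dv|Dv] := pselect (D v).
  by rewrite !on_core_in ?h.
by rewrite !on_coreN.
Qed.

Lemma comm_span_sum s : comm_sum s \in comm_span.
Proof. by apply/asboolP; exists s. Qed.

Lemma comm_span_closed : GRing.subsemimod_closed comm_span.
Proof.
split; first split.
- apply/asboolP; exists [::]; apply/funext => v; rewrite /comm_sum.
  have [Dv|Dv] := pselect (D v); last by rewrite on_coreN.
  by rewrite on_core_in // big_nil.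
- move=> _ _ /asboolP[s ->] /asboolP[t ->]; apply/asboolP; exists (s ++ t).
  apply/funext => v; transitivity (comm_sum s v + comm_sum t v) => //; rewrite /comm_sum.
  have [Dv|Dv] := pselect (D v); last by rewrite !(on_coreN _ Dv) addr0.
  by rewrite !on_core_in // big_cat /=.
- move=> k _ /asboolP[s ->]; apply/asboolP.
  exists [seq (k *: t.1.1, t.1.2, t.2) | t <- s].
  apply/funext => v; transitivity (k *: comm_sum s v) => //; rewrite /comm_sum.
  have [Dv|Dv] := pselect (D v); last by rewrite !(on_coreN _ Dv) scaler0.
  rewrite !on_core_in // big_map scaler_sumr; apply: eq_bigr => -[[x y] z] _ /=.
  have r0 w : pi 0 w = 0.
    by have := repP pi (-1) 0 0 w; rewrite scaler0 addr0 scaleN1r addNr.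
  by have := repP pi k x 0 (F (pi y (pi z v)) - pi y (F (pi z v)));
    rewrite !addr0 r0 addr0.
Qed.
HB.instance Definition _ :=
  GRing.isSubmodClosed.Build R[i] (H -> H) comm_span comm_span_closed.

Record comm_space := CommSpace { cval :> H -> H; _ : cval \in comm_span }.
HB.instance Definition _ := [isSub for cval].
HB.instance Definition _ := [Choice of comm_space by <:].
HB.instance Definition _ := [SubChoice_isSubLmodule of comm_space by <:].

Lemma comm_space_rep (T : comm_space) : exists s, cval T = comm_sum s.
Proof. by case: T => T /= /asboolP. Qed.

Definition comm_seq (T : comm_space) := sval (cid (comm_space_rep T)).
Lemma comm_seqE T : cval T = comm_sum (comm_seq T).
Proof. exact: svalP (cid (comm_space_rep T)). Qed.

Lemma cvalE T v : D v -> cval T v = ext (comm_seq T) v.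
Proof. by move=> Dv; rewrite comm_seqE /comm_sum on_core_in. Qed.
Lemma cvalN T v : ~ D v -> cval T v = 0.
Proof. by move=> Dv; rewrite comm_seqE /comm_sum on_coreN. Qed.

Lemma comm_spaceP (T T' : comm_space) : (forall v, D v -> T v = T' v) -> T = T'.
Proof.
move=> h; apply: val_inj; apply/funext => v /=.
by have [Dv|Dv] := pselect (D v); [exact: h|rewrite !cvalN].
Qed.

Lemma cvalP k (T T' : comm_space) v : (k *: T + T') v = k *: T v + T' v.
Proof. by []. Qed.

(* Any two families of triples representing the same operator on the core     *)
(* agree on pi(A) core.                                                       *)
Lemma ext_unique s t : (forall v, D v -> ext s v = ext t v) ->
  forall v, good v -> ext s v = ext t v.
Proof.
move=> h v gv; apply/eqP; rewrite -subr_eq0; apply/eqP.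
have nr0 w (x : A) : pi (- x) w = - pi x w.
  have r0 w' : pi 0 w' = 0.
    by have := repP pi (-1) 0 0 w'; rewrite scaler0 addr0 scaleN1r addNr.
  by have := repP pi (-1) x 0 w; rewrite !addr0 r0 addr0 !scaleN1r.
have E w : ext (s ++ [seq (- t.1.1, t.1.2, t.2) | t <- t]) w = ext s w - ext t w.
  rewrite /ext big_cat big_map /=; congr (_ + _); rewrite -sumrN.
  by apply: eq_bigr => -[[x y] z] _ /=; rewrite nr0.
by rewrite -E; apply: ext_core0 gv => w Dw; rewrite E h // subrr.
Qed.

Definition comm_of (s : seq (A * A * A)) : comm_space :=
  CommSpace (comm_span_sum s).

Lemma comm_ofE s v : D v -> comm_of s v = ext s v.
Proof. by move=> Dv; rewrite /= /comm_sum on_core_in. Qed.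

Lemma ext_comm_seq (T : comm_space) s : (forall v, D v -> T v = ext s v) ->
  forall v, good v -> ext (comm_seq T) v = ext s v.
Proof. by move=> h; apply: ext_unique => v Dv; rewrite -cvalE // h. Qed.

Lemma ext_comm_seqP k (T T' : comm_space) v : good v ->
  ext (comm_seq (k *: T + T')) v = k *: ext (comm_seq T) v + ext (comm_seq T') v.
Proof.
move=> gv.
pose s := [seq (k *: t.1.1, t.1.2, t.2) | t <- comm_seq T] ++ comm_seq T'.
have r0 w : pi 0 w = 0.
  by have := repP pi (-1) 0 0 w; rewrite scaler0 addr0 scaleN1r addNr.
have E w : ext s w = k *: ext (comm_seq T) w + ext (comm_seq T') w.
  rewrite /ext big_cat big_map /=; congr (_ + _); rewrite scaler_sumr.
  apply: eq_bigr => -[[x y] z] _ /=.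
  by have := repP pi k x 0 (F (pi y (pi z w)) - pi y (F (pi z w)));
    rewrite !addr0 r0 addr0.
by rewrite -E; apply: ext_comm_seq gv => w Dw; rewrite E cvalP !cvalE.
Qed.

(* The actions and the involution are computed on some expression of T as a   *)
(* sum of commutators; they do not depend on it, see comm_lactE,              *)
(* comm_ract_sum and comm_star_sum.                                           *)
Definition comm_lact (x : A) (T : comm_space) : comm_space :=
  comm_of [seq (x * t.1.1, t.1.2, t.2) | t <- comm_seq T].

Definition comm_ract (T : comm_space) (x : A) : comm_space :=
  comm_of [seq (t.1.1, t.1.2, t.2 * x) | t <- comm_seq T].

Definition comm_star (T : comm_space) : comm_space :=
  comm_of [seq (- star t.2, star t.1.2, star t.1.1) | t <- comm_seq T].


Let E (T : comm_space) := ext (comm_seq T).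

Let E_of s v : good v -> E (comm_of s) v = ext s v.
Proof. by move=> gv; apply: ext_comm_seq gv => w Dw; apply: comm_ofE. Qed.

Let eqE (T T' : comm_space) : (forall v, D v -> E T v = E T' v) -> T = T'.
Proof. by move=> h; apply: comm_spaceP => v Dv; rewrite !cvalE //; exact: h. Qed.

Let ED k T T' v : good v -> E (k *: T + T') v = k *: E T v + E T' v.
Proof. exact: ext_comm_seqP. Qed.

Let EPv T k u v : good u -> good v -> E T (k *: u + v) = k *: E T u + E T v.
Proof. exact: ext_linear. Qed.

Let E_lact x T v : good v -> E (comm_lact x T) v = pi x (E T v).
Proof.
move=> gv; rewrite E_of // /E /ext big_map linear_sum.
by apply: eq_bigr => -[[y z] w] _ /=; rewrite repM.
Qed.

Let E_ract x T v : good v -> E (comm_ract T x) v = E T (pi x v).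
Proof.
move=> gv; rewrite E_of // /E /ext big_map.
by apply: eq_bigr => -[[y z] w] _ /=; rewrite repM.
Qed.

Let pi0 w : pi 0 w = 0.
Proof. by have := repP pi (-1) 0 0 w; rewrite scaler0 addr0 scaleN1r addNr. Qed.
Let piZ k x w : pi (k *: x) w = k *: pi x w.
Proof. by have := repP pi k x 0 w; rewrite !addr0 pi0 addr0. Qed.
Let piN x w : pi (- x) w = - pi x w.
Proof. by rewrite -scaleN1r piZ scaleN1r. Qed.

Let E_star T u v : good u -> good v -> inner u (E (comm_star T) v) = inner (E T u) v.
Proof.
move=> gu gv; rewrite E_of // ext_adj // -innerNr /ext !big_map -sumrN.
by congr (inner u _); apply: eq_bigr => -[[x y] z] _ /=; rewrite piN.
Qed.

Lemma comm_lactE x (T : comm_space) v : comm_lact x T v = pi x (T v).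
Proof.
have [Dv|Dv] := pselect (D v); last by rewrite !cvalN // linear0.
rewrite !cvalE //; exact/E_lact/good_core.
Qed.

Lemma comm_ract_sum s x :
  comm_ract (comm_of s) x = comm_of [seq (t.1.1, t.1.2, t.2 * x) | t <- s].
Proof.
apply: eqE => v Dv; have gv := good_core Dv; rewrite E_ract // !E_of //.
  rewrite /ext big_map; apply: eq_bigr => -[[y z] w] _ /=; by rewrite repM.
exact: good_rep.
Qed.

Lemma comm_star_sum s : comm_star (comm_of s) =
  comm_of [seq (- star t.2, star t.1.2, star t.1.1) | t <- s].
Proof.
apply: eqE => v Dv; have gv := good_core Dv.
apply/eqP; rewrite -subr_eq0; apply/eqP/core_inner0 => u Du.
have gu := good_core Du.
rewrite innerDr innerNr E_star // !E_of // ext_adj // -innerNr /ext !big_map -sumrN.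
apply/eqP; rewrite subr_eq0; apply/eqP; congr (inner u _).
by apply: eq_bigr => -[[x y] z] _ /=; rewrite piN.
Qed.

Lemma comm_diff_key x :
  on_core (fun v => 'i *: F (pi x v) - pi x ('i *: F v)) = comm_sum [:: ('i%:A, x, 1)].
Proof.
apply: on_core_ext => v Dv.
by rewrite big_seq1 /= piZ !rep1 scalerBr linearZ.
Qed.

Lemma comm_diff_span x :
  on_core (fun v => 'i *: F (pi x v) - pi x ('i *: F v)) \in comm_span.
Proof. by rewrite comm_diff_key comm_span_sum. Qed.

Definition comm_diff (x : A) : comm_space := CommSpace (comm_diff_span x).

Let E_diff x v : good v -> E (comm_diff x) v = 'i *: (F (pi x v) - pi x (F v)).
Proof.
move=> gv; rewrite (_ : comm_diff x = comm_of [:: ('i%:A, x, 1)]).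
  by rewrite E_of // /ext big_seq1 /= piZ !rep1.
exact/val_inj/comm_diff_key.
Qed.

Fact comm_lact_bilinear : bilinear_for *:%R *:%R comm_lact.
Proof.
split=> [T k x y|x k T T'] /=; apply: eqE => v Dv; have gv := good_core Dv.
  by rewrite ED // !E_lact // repP.
by rewrite ED // !E_lact // ED // linearP.
Qed.
HB.instance Definition _ :=
  bilinear_isBilinear.Build R[i] A comm_space comm_space *:%R *:%R
    comm_lact comm_lact_bilinear.

Fact comm_ract_bilinear : bilinear_for *:%R *:%R comm_ract.
Proof.
split=> [x k T T'|T k x y] /=; apply: eqE => v Dv; have gv := good_core Dv.
  by rewrite ED // !E_ract // ED //; apply: good_rep.
rewrite ED // !E_ract // repP EPv //; exact: good_rep.
Qed.
HB.instance Definition _ :=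
  bilinear_isBilinear.Build R[i] comm_space A comm_space *:%R *:%R
    comm_ract comm_ract_bilinear.

Fact comm_diff_linear : linear comm_diff.
Proof.
move=> k x y; apply: eqE => v Dv; have gv := good_core Dv.
rewrite ED // !E_diff // !repP op_linear // scalerA mulrC -scalerA -scalerDr.
by congr (_ *: _); rewrite scalerBr opprD addrACA.
Qed.
HB.instance Definition _ :=
  GRing.isLinear.Build R[i] A comm_space _ comm_diff comm_diff_linear.

Fact comm_lact1 T : comm_lact 1 T = T.
Proof. by apply: eqE => v /good_core gv; rewrite E_lact // rep1. Qed.
Fact comm_lactM x y T : comm_lact (x * y) T = comm_lact x (comm_lact y T).
Proof. by apply: eqE => v /good_core gv; rewrite !E_lact // repM. Qed.
Fact comm_ract1 T : comm_ract T 1 = T.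
Proof. by apply: eqE => v /good_core gv; rewrite E_ract // rep1. Qed.
Fact comm_ractM T x y : comm_ract T (x * y) = comm_ract (comm_ract T x) y.
Proof.
apply: eqE => v /good_core gv; rewrite !E_ract // ?repM //; exact: good_rep.
Qed.
Fact comm_lractA x T y : comm_ract (comm_lact x T) y = comm_lact x (comm_ract T y).
Proof.
apply: eqE => v /good_core gv; rewrite E_ract // !E_lact ?E_ract //; exact: good_rep.
Qed.
Fact comm_diffM x y :
  comm_diff (x * y) = comm_lact x (comm_diff y) + comm_ract (comm_diff x) y.
Proof.
apply: eqE => v /good_core gv; have gy := good_rep y gv.
rewrite -[comm_lact _ _]scale1r ED // scale1r E_lact // E_ract // !E_diff //.
rewrite !repM linearZ -scalerDr (linearB (pi x)); congr (_ *: _).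
by rewrite [RHS]addrC addrA subrK.
Qed.

Let E_sum (I : Type) (r : seq I) (T : I -> comm_space) v : good v ->
  E (\sum_(i <- r) T i) v = \sum_(i <- r) E (T i) v.
Proof.
move=> gv; elim: r => [|i r IH].
  rewrite !big_nil; have := ED (-1) 0 0 gv.
  by rewrite scaler0 addr0 scaleN1r addNr.
rewrite !big_cons -IH -[T i]scale1r ED //; congr (_ + _); by rewrite !scale1r.
Qed.

Fact comm_span_diff T : exists s : seq (A * A * A),
  T = \sum_(t <- s) comm_ract (comm_lact t.1.1 (comm_diff t.1.2)) t.2.
Proof.
exists [seq (- 'i *: t.1.1, t.1.2, t.2) | t <- comm_seq T].
apply: eqE => v /good_core gv; rewrite E_sum // big_map.
apply: eq_bigr => -[[x y] z] _ /=; have gz := good_rep z gv.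
rewrite E_ract // E_lact // E_diff // piZ linearZ /= scalerA.
by rewrite mulNr -expr2 sqrCi opprK scale1r.
Qed.

Definition comm_fodc : fodc A := Fodc comm_lact1 comm_lactM comm_ract1 comm_ractM
  comm_lractA comm_diffM comm_span_diff.

Fact comm_starK : involutive comm_star.
Proof.
move=> T; apply: eqE => v /good_core gv.
apply/eqP; rewrite -subr_eq0; apply/eqP/core_inner0 => u /good_core gu.
have swap (u' v' : H) : inner u' v' = (inner v' u')^*.
  transitivity ((-1) ^+ false * (inner v' u')^*); first exact: hermitian_subproof.
  by rewrite expr0 mul1r.
by rewrite innerDr innerNr E_star // swap E_star // -swap subrr.
Qed.

Fact comm_starP k T T' : comm_star (k *: T + T') = k^* *: comm_star T + comm_star T'.
Proof.
apply: eqE => v /good_core gv.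
apply/eqP; rewrite -subr_eq0; apply/eqP/core_inner0 => u /good_core gu.
rewrite innerDr innerNr E_star // !ED // innerDl innerZl innerDr innerZr conjCK.
by rewrite !E_star // subrr.
Qed.

Fact comm_starE (x y z : A) :
  comm_star (fform comm_fodc x y z) = fform comm_fodc (star z) (star y) (star x).
Proof.
apply: eqE => v /good_core gv.
apply/eqP; rewrite -subr_eq0; apply/eqP/core_inner0 => u /good_core gu.
have gz w : good w -> good (pi z w) by apply: good_rep.
have gx w : good w -> good (pi (star x) w) by apply: good_rep.
have FE a b c w : good w ->
    E (fform comm_fodc a b c) w = 'i *: comm_op (a, b, c) w.
  move=> gw; have gc := good_rep c gw.
  by rewrite /fform /= E_ract // E_lact // E_diff // linearZ.
rewrite innerDr innerNr E_star // !FE // innerZl innerZr comm_op_adj //.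
by rewrite conjCi mulrN mulNr subrr.
Qed.

Definition comm_calculus : star_fodc A :=
  @StarFodc R A comm_fodc comm_star comm_starK comm_starP comm_starE.

End CommutatorCalculus.

Section CommutatorRepresentation.
Variables (R : realType) (A : starAlgType R) (H : hilbertType R).

Definition commutator_rep (G : star_fodc A) (P : comm_pair A H) : Prop :=
  exists rho : {linear G -> comm_calculus P}, star_fodc_hom rho.

Definition bounded_on (D : set H) (T : H -> H) : Prop :=
  exists M : R, forall v, D v -> `|T v| <= (M%:C)%C * `|v|.

End CommutatorRepresentation.

(* Main.v *)
From HB Require Import structures.
Require Import Defs.
From mathcomp Require Import all_boot all_order all_algebra.
From mathcomp Require Import all_classical all_reals all_analysis.
From mathcomp.real_closed Require Import complex.
From mathcomp Require Import ring lra.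
Set Implicit Arguments.
Unset Strict Implicit.
Unset Printing Implicit Defensive.
Import Order.TTheory GRing.Theory Num.Theory.
Import numFieldNormedType.Exports.
Local Open Scope classical_set_scope.
Local Open Scope ring_scope.

(** The point is that the commutation rules between the forms and the algebra
are multiplicative: they rescale the operators involved, and a bounded operator
does not survive a rescaling of its own norm.

Write W x for S(x_(1)) d x_(2), taken in the bimodule of commutators, and eps
for the counit. Since dx = x_(1) W(x_(2)), it is enough that W vanishes at a, b,
c and d (fdiff_eq0). The relations W r = 0, for r in the right ideal of the
calculus, are transported by the homomorphism to the bimodule of commutators
(rep_omega_eq0), and the rule W(x) y = y_(1) W(x y_(2)) for eps(x) = 0
(omega_ract) turns them into commutation rules between the operators W x and
the generators. As the differentials are bounded, so are all forms
(form_bounded). Two analytic facts then exclude nonzero forms.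

A form T with T a = s^-1 a T, T d = s d T, T b = s b T, T c = s^-1 c T, where s
is real and s^2 <> 1, is zero (twisted_eq0). One may assume T symmetric. Then
the adjoint of b T is s^-1 times (adjoint of b) T; as b is normal, this adjoint
has norm |b T| / |s|, hence b T = 0. On the kernel of b, which therefore
contains the range of T, a and d are isometric, so |T v| = |a T v| = |s| |T a v|
and |T v| = |d T v| = |T d v| / |s|; one of these contracts the norm of T.

A form T that commutes or anticommutes with d and satisfies
Z b = k a T + s b Z with k <> 0 for some form Z is zero (quasicentral_eq0).
Evaluate the identity at d^(m+1) v and pair it with d^m w. The rule
b d^m = q^m d^m b makes the two terms that contain Z of order q^m, while the
remaining one is k times the inner product of d^(m+1) T v and d^(m+1) w. But
|d^m x|^2 cannot be bounded by a multiple of q^m unless x = 0 (rnorm_dX_ge,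
slow_decay_eq0).

In the 3D-calculus W b and W c are twisted with s = q, and W a = W(a - 1) with
s = q^2, which settles the matter. In the 4D-calculi, with sign e, the form
W(bc) is twisted with s = e q, hence zero. Then W b and W c commute up to the
sign e with the generators, and they appear as the defect in the commutation
rules of W(a - d) with b and c; so they vanish by the second fact and its
adjoint. Now W(a - d) is twisted with s = (e q)^-1, hence zero, and the last
generator of the ideal says that a nonzero multiple of W a is zero. *)

(** * Real inequalities in a complex Hilbert space *)

Section HilbertSpace.
Variables (R : realType) (H : hilbertType R).
Implicit Types u v w x : H.

Lemma innerDl u u' v : inner (u + u') v = inner u v + inner u' v.
Proof. exact: linearDl. Qed.
Lemma innerDr u v v' : inner u (v + v') = inner u v + inner u v'.
Proof. exact: linearDr. Qed.
Lemma innerNl u v : inner (- u) v = - inner u v.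
Proof. exact: linearNl. Qed.
Lemma innerNr u v : inner u (- v) = - inner u v.
Proof. exact: linearNr. Qed.
Lemma innerZl k u v : inner (k *: u) v = k * inner u v.
Proof. exact: linearZl_LR. Qed.
Lemma inner_conj u v : inner u v = (inner v u)^*.
Proof.
transitivity ((-1) ^+ false * (inner v u)^*); first exact: hermitian_subproof.
by rewrite expr0 mul1r.
Qed.

(** Norms and inner products take values in R[i], whose order is partial; their
real parts live in a totally ordered field and suffice for all estimates. *)
Definition rnorm v : R := complex.Re `|v|.
Definition rinner u v : R := complex.Re (inner u v).

Lemma rnormE v : `|v| = (rnorm v)%:C%C.
Proof. by rewrite [LHS]complexE (ger0_Im (normr_ge0 v)) mulr0 addr0. Qed.
Lemma rnorm_ge0 v : 0 <= rnorm v.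
Proof. by have := normr_ge0 v; rewrite rnormE lecR. Qed.
Lemma rnorm_eq0 v : rnorm v = 0 -> v = 0.
Proof. by move=> v0; apply/normr0_eq0; rewrite rnormE v0. Qed.
Lemma rnormD u v : rnorm (u + v) <= rnorm u + rnorm v.
Proof. by have := ler_normD u v; rewrite !rnormE -rmorphD lecR. Qed.
Lemma rnormN v : rnorm (- v) = rnorm v.
Proof. by rewrite /rnorm normrN. Qed.
Lemma rnormZ (t : R) v : rnorm (t%:C%C *: v) = `|t| * rnorm v.
Proof. by rewrite /rnorm normrZ normc_def /= expr0n addr0 sqrtr_sqr rnormE -rmorphM. Qed.
Lemma rnorm_sq v : rnorm v ^+ 2 = rinner v v.
Proof. by rewrite /rinner -inner_norm rnormE -rmorphXn. Qed.

Lemma rinnerDl u u' v : rinner (u + u') v = rinner u v + rinner u' v.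
Proof. by rewrite /rinner innerDl raddfD. Qed.
Lemma rinnerDr u v v' : rinner u (v + v') = rinner u v + rinner u v'.
Proof. by rewrite /rinner innerDr raddfD. Qed.
Lemma rinnerNl u v : rinner (- u) v = - rinner u v.
Proof. by rewrite /rinner innerNl raddfN. Qed.
Lemma rinnerNr u v : rinner u (- v) = - rinner u v.
Proof. by rewrite /rinner innerNr raddfN. Qed.
Lemma rinnerZl (t : R) u v : rinner (t%:C%C *: u) v = t * rinner u v.
Proof. by rewrite /rinner innerZl; case: (inner u v) => x y /=; rewrite mul0r subr0. Qed.
Lemma rinnerC u v : rinner u v = rinner v u.
Proof. by rewrite /rinner inner_conj; case: (inner v u). Qed.
Lemma rinnerZr (t : R) u v : rinner u (t%:C%C *: v) = t * rinner u v.
Proof. by rewrite rinnerC rinnerZl rinnerC. Qed.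

(** The Cauchy-Schwarz inequality for real parts, from the nonnegativity of
the square norm of |v| u - |u| v. *)
Lemma rinner_le u v : rinner u v <= rnorm u * rnorm v.
Proof.
have [u0|u0] := eqVneq (rnorm u) 0.
  rewrite u0 mul0r (rnorm_eq0 u0); have := rinnerDl 0 0 v; rewrite addr0; lra.
have [v0|v0] := eqVneq (rnorm v) 0.
  rewrite v0 mulr0 (rnorm_eq0 v0); have := rinnerDr u 0 0; rewrite addr0; lra.
have uv0 : 0 < rnorm u * rnorm v.
  by rewrite mulr_gt0 // lt_def ?u0 ?v0 rnorm_ge0.
have := sqr_ge0 (rnorm ((rnorm v)%:C%C *: u - (rnorm u)%:C%C *: v)).
rewrite rnorm_sq !(rinnerDl, rinnerDr, rinnerNl, rinnerNr, rinnerZl, rinnerZr).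
rewrite (rinnerC v u) -!rnorm_sq => h.
rewrite -(ler_pM2l uv0); nra.
Qed.

(** Norms are computed by pairing with a dense set; the real part suffices. This
is how a bound on an operator defined on a dense domain passes to its adjoint. *)
Lemma dense_rnorm_le (D : set H) x C : dense D -> 0 <= C ->
  (forall w, D w -> rinner x w <= C * rnorm w) -> rnorm x <= C.
Proof.
move=> Dd C0 h; rewrite leNgt; apply/negP => xC.
have x0 : 0 < rnorm x by apply: le_lt_trans xC.
pose e := rnorm x * (rnorm x - C) / (C + rnorm x) / 2.
have e0 : 0 < e by rewrite !divr_gt0 ?mulr_gt0 ?subr_gt0 ?ltr_wpDl.
have eC : 0 < e%:C%C by rewrite ltcR.
have [w []] := Dd (ball x e%:C%C) (ex_intro _ x (ballxx x eC)) (ball_open x e%:C%C).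
rewrite -ball_normE /= rnormE ltcR => ltw /h.
have E : e * (C + rnorm x) * 2 = rnorm x * (rnorm x - C).
  by rewrite /e; field; rewrite gt_eqF ?ltr_wpDl.
have := rinner_le x (x - w); rewrite rinnerDr rinnerNr -rnorm_sq.
have := rnormD x (- (x - w)); rewrite rnormN opprB subrKC => wx.
have := rnorm_ge0 w; have := rnorm_ge0 (x - w).
nra.
Qed.

End HilbertSpace.

(** * Forms as bounded operators on the good vectors *)

Section CommutatorOperators.
Variables (R : realType) (A : starAlgType R) (H : hilbertType R).
Variable P : comm_pair A H.
Local Notation G := (comm_calculus P).
Local Notation rho := (cp_rep P).
Implicit Types (T : G) (x y : A) (u v w : H).

Lemma rep_bounded x : exists2 M : R, 0 <= M &
  forall v, rnorm (rho x v) <= M * rnorm v.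
Proof.
have /linear_boundedP/pinfty_ex_gt0[K K0 h] :=
  (linear_bounded_continuous (rho x)).2 (@rep_continuous _ _ _ rho x).
exists (complex.Re K) => [|v].
  by move: K0; rewrite ltcE => /andP[_ /ltW].
have := h v; rewrite !rnormE lecE => /andP[_].
by case: (K) => s t /=; rewrite mulr0 subr0.
Qed.

(** A form is an operator on the core, which is not stable under the
representation. The good vectors are, and they are dense; extending forms to
them turns the two actions into composition with the representation. *)
Definition cop T v : H := \sum_(t <- comm_seq T) comm_op P t v.

Lemma cop_core T v : core P v -> cval T v = cop T v.
Proof. exact: cvalE. Qed.

Lemma cop_of s v : good P v -> cop (comm_of P s) v = \sum_(t <- s) comm_op P t v.
Proof. by move=> gv; apply: ext_comm_seq gv => u; apply: comm_ofE. Qed.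

Lemma copP (k : R[i]) T T' v : good P v -> cop (k *: T + T') v = k *: cop T v + cop T' v.
Proof. exact: ext_comm_seqP. Qed.
Lemma copD T T' v : good P v -> cop (T + T') v = cop T v + cop T' v.
Proof. by move=> gv; rewrite -[T]scale1r copP // !scale1r. Qed.
Lemma cop0 v : good P v -> cop 0 v = 0.
Proof. by move=> gv; apply: (addrI (cop 0 v)); rewrite -copD // !addr0. Qed.
Lemma copZ (k : R[i]) T v : good P v -> cop (k *: T) v = k *: cop T v.
Proof. by move=> gv; rewrite -[k *: T]addr0 copP // cop0 // addr0. Qed.

Lemma cop_lact x T v : good P v -> cop (lact G x T) v = rho x (cop T v).
Proof.
move=> gv; rewrite cop_of // /cop big_map linear_sum.
by apply: eq_bigr => -[[y z] w] _ /=; rewrite repM.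
Qed.

Lemma cop_ract x T v : good P v -> cop (ract G T x) v = cop T (rho x v).
Proof.
move=> gv; rewrite cop_of // /cop big_map.
by apply: eq_bigr => -[[y z] w] _ /=; rewrite repM.
Qed.

Lemma cop_star T u v : good P u -> good P v ->
  inner (cop T u) v = inner u (cop (fstar T) v).
Proof.
move=> gu gv; rewrite cop_of // ext_adj // -innerNr !big_map -sumrN.
congr (inner u _); apply: eq_bigr => -[[x y] z] _ /=.
have r0 w : rho 0 w = 0.
  by have := repP rho (-1) 0 0 w; rewrite scaler0 addr0 scaleN1r addNr.
by have := repP rho (-1) (star z) 0; rewrite !addr0 scaleN1r => ->; rewrite r0 addr0 scaleN1r.
Qed.

Lemma cop_eq0 T : (forall v, good P v -> cop T v = 0) -> T = 0.
Proof.
move=> h; apply: comm_spaceP => v Dv.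
by rewrite cop_core // h //; apply: good_core.
Qed.

Definition bounded_by (f : H -> H) (M : R) :=
  forall v, good P v -> rnorm (f v) <= M * rnorm v.

Lemma good_dense : dense (good P).
Proof.
move=> O O0 oO; have [v [Ov Dv]] := core_dense P O0 oO.
by exists v; split=> //; apply: good_core.
Qed.

Lemma form_inner_eq T T' : (forall u v, good P u -> good P v ->
  inner u (cop T v) = inner u (cop T' v)) -> T = T'.
Proof.
move=> h; apply: comm_spaceP => v Dv; apply/eqP; rewrite -subr_eq0; apply/eqP.
apply: (@core_inner0 _ _ _ P) => u Du; rewrite !cop_core // innerDr innerNr.
by rewrite h ?subrr //; apply: good_core.
Qed.

Lemma fstar_lact x T : fstar (lact G x T) = ract G (fstar T) (star x).
Proof.
apply: form_inner_eq => u v gu gv.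
rewrite -cop_star // cop_lact // cop_ract // rep_star cop_star //.
exact: good_rep.
Qed.

Lemma fstar_ract x T : fstar (ract G T x) = lact G (star x) (fstar T).
Proof. by rewrite -[LHS]fstarK -[in LHS](fstarK T) -[in LHS](starK x) -fstar_lact !fstarK. Qed.

Hypothesis diff_bounded : forall x, bounded_on (core P) (cval (fdiff G x)).

(** The bound is only assumed on the core. It extends to good vectors because
the adjoint of d x is d of the adjoint of x, and that is bounded on the core. *)
Lemma fdiff_bounded_by x : exists2 M, 0 <= M & bounded_by (cop (fdiff G x)) M.
Proof.
have [M hM] := diff_bounded (star x).
exists `|M| => // v gv; apply: (dense_rnorm_le (core_dense P)) => [|u Du].
  by rewrite mulr_ge0 ?rnorm_ge0.
have gu : good P u by apply: good_core.
have sE : fstar (fdiff G x) = fdiff G (star x).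
  have s1 : star (1 : A) = 1 by rewrite -[LHS]mulr1 -{2}[1]starK -starM mulr1 starK.
  have E y : fdiff G y = fform G 1 y 1 by rewrite /fform lact1 ract1.
  by rewrite !E fstarE s1.
rewrite /rinner cop_star // sE; apply: le_trans (rinner_le _ _) _.
rewrite -cop_core // mulrC mulrAC ler_wpM2r ?rnorm_ge0 //.
have := hM _ Du; rewrite !rnormE -rmorphM lecR => /le_trans; apply.
by rewrite ler_wpM2r ?rnorm_ge0 // ler_norm.
Qed.

Lemma form_bounded T : exists2 M, 0 <= M & bounded_by (cop T) M.
Proof.
have [s ->] := fodc_span T; elim: s => [|[[x y] z] s [M M0 hM]].
  by exists 0 => // v gv; rewrite big_nil cop0 // mul0r /rnorm normr0.
have [Mx Mx0 hx] := rep_bounded x; have [Mz Mz0 hz] := rep_bounded z.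
have [My My0 hy] := fdiff_bounded_by y.
exists (Mx * (My * Mz) + M) => [|v gv]; first by rewrite addr_ge0 ?mulr_ge0.
have gz := good_rep z gv.
rewrite big_cons copD // mulrDl; apply: le_trans (rnormD _ _) _.
apply: lerD; last exact: hM.
rewrite cop_ract // cop_lact //; apply: le_trans (hx _) _.
rewrite -!mulrA ler_wpM2l //; apply: le_trans (hy _ gz) _.
by rewrite ler_wpM2l.
Qed.

End CommutatorOperators.

(** * Geometric decay *)

Section RealSequences.
Variable R : realType.
Implicit Types r x C : R.

Lemma geometric_small r e : 0 <= r < 1 -> 0 < e -> exists n, r ^+ n < e.
Proof.
case/andP=> r0 r1 e0.
have : `|r| < 1 by rewrite ger0_norm.
move/cvg_expr/cvgr0Pnorm_lt/(_ _ e0) => [n _ /(_ n (leqnn n)) /=].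
by rewrite ger0_norm ?exprn_ge0 //; exists n.
Qed.

Lemma geometric_eq0 r x C : 0 <= r < 1 -> 0 <= x -> 0 <= C ->
  (forall n, x <= C * r ^+ n) -> x = 0.
Proof.
move=> r01 x0 C0 h; apply/eqP; rewrite eq_le x0 andbT leNgt; apply/negP => xp.
have [n] := geometric_small r01 (divr_gt0 xp (ltr_wpDl C0 (@ltr01 R))).
rewrite ltr_pdivlMr ?ltr_wpDl // => hn; have := h n.
have : 0 <= r ^+ n by case/andP: r01 => *; rewrite exprn_ge0.
nra.
Qed.

(** The factors 1 - q^(m+1) tend to 1, so that a nonzero sequence of this kind
eventually decreases by factors at least (1 + q) / 2, which is greater than q. *)
Lemma slow_decay_eq0 (q : R) (x : nat -> R) C : 0 < q < 1 -> 0 <= C ->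
  (forall m, 0 <= x m) -> (forall m, (1 - q ^+ m.+1) * x m <= x m.+1) ->
  (forall m, x m <= C * q ^+ m) -> x 0%N = 0.
Proof.
case/andP=> q0 q1 C0 x0 hx hC.
pose r := (1 + q) / 2; have r0 : 0 < r by rewrite /r; lra.
have qr : q < r by rewrite /r; lra.
have [N hN] : exists n, q ^+ n < 1 - r.
  by apply: geometric_small; [rewrite ltW|rewrite /r; lra].
have xN k : r ^+ k * x N <= x (N + k)%N.
  elim: k => [|k IH]; first by rewrite mul1r addn0.
  rewrite addnS exprS -mulrA; apply: le_trans (hx _).
  have rk : r <= 1 - q ^+ (N + k).+1.
    have : q ^+ (N + k).+1 <= q ^+ N.
      by rewrite ler_wiXn2l ?(ltW q0) ?(ltW q1) // -addnS leq_addr.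
    by move: hN; lra.
  apply: le_trans (ler_wpM2l (ltW r0) IH) _.
  exact: ler_wpM2r.
have xN0 : x N = 0.
  have rq : 0 <= q / r < 1 by rewrite divr_ge0 ?ltW //= ltr_pdivrMr // mul1r.
  apply: (geometric_eq0 (C := C * q ^+ N) rq) => //.
    by rewrite mulr_ge0 // exprn_ge0 // ltW.
  move=> k; rewrite expr_div_n mulrA ler_pdivlMr ?exprn_gt0 // mulrC.
  by apply: le_trans (xN k) _; rewrite -mulrA -exprD.
elim: N xN0 {hN xN} => // N IH xS; apply: IH; apply/eqP; rewrite eq_le x0 andbT.
have := hx N; rewrite xS pmulr_rle0 // subr_gt0.
by rewrite exprn_ilt1 ?ltW.
Qed.

End RealSequences.

(** * Commutation rules that force a bounded form to vanish *)

Section Twisted.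
Variables (R : realType) (q : R) (hq : 0 < q < 1) (G : fodc (suq2 hq)).
Local Notation a := (suq2_of_gen hq Ga).
Local Notation b := (suq2_of_gen hq Gb).
Local Notation c := (suq2_of_gen hq Gc).
Local Notation d := (suq2_of_gen hq Gd).

(** The same factor serves a and c on the one hand, b and d on the other:
these are the columns of the fundamental corepresentation. For x of counit 0,
the form W x satisfies these rules as soon as W (x * b) = W (x * c) = 0,
W (x * a) = s^-1 W x and W (x * d) = s W x. *)
Definition twisted (s : R) (T : G) := [/\
  ract G T a = (s^-1)%:C%C *: lact G a T,
  ract G T b = s%:C%C *: lact G b T,
  ract G T c = (s^-1)%:C%C *: lact G c T &
  ract G T d = s%:C%C *: lact G d T].

End Twisted.

Section TwistedForms.
Variables (R : realType) (q : R) (hq : 0 < q < 1) (H : hilbertType R).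
Variable P : comm_pair (suq2 hq) H.
Local Notation A := (suq2 hq).
Local Notation G := (comm_calculus P).
Local Notation rho := (cp_rep P).
Local Notation p := (q%:C)%C.
Local Notation a := (suq2_of_gen hq Ga).
Local Notation b := (suq2_of_gen hq Gb).
Local Notation c := (suq2_of_gen hq Gc).
Local Notation d := (suq2_of_gen hq Gd).
Implicit Types (T : G) (x y : A) (u v w : H).

Lemma rep0 v : rho 0 v = 0.
Proof. by have := repP rho (-1) 0 0 v; rewrite scaler0 addr0 scaleN1r addNr. Qed.
Lemma repZ (k : R[i]) x v : rho (k *: x) v = k *: rho x v.
Proof. by have := repP rho k x 0 v; rewrite rep0 !addr0. Qed.
Lemma repD x y v : rho (x + y) v = rho x v + rho y v.
Proof. by have := repP rho 1 x y v; rewrite !scale1r. Qed.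
Lemma rinner_rep x u v : rinner (rho x u) v = rinner u (rho (star x) v).
Proof. by rewrite /rinner rep_star. Qed.
Lemma rinner_rep_star x u v : rinner u (rho x v) = rinner (rho (star x) u) v.
Proof. by rewrite rinner_rep starK. Qed.

Lemma star_b : star b = - p *: c.
Proof. exact: starE. Qed.
Lemma star_c : star c = - p^-1 *: b.
Proof. exact: starE. Qed.
Lemma star_a : star a = d.
Proof. exact: starE. Qed.
Lemma star_d : star d = a.
Proof. exact: starE. Qed.

Lemma b_normal : star b * b = b * star b.
Proof. by rewrite star_b -scalerAl -scalerAr suq2_bcE. Qed.
Lemma ad_star : a * d = 1 - b * star b.
Proof. by rewrite star_b -scalerAr scaleNr opprK suq2_adE. Qed.
Lemma da_star : d * a = 1 - (q ^- 2)%:C%C *: (b * star b).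
Proof.
rewrite star_b -scalerAr scaleNr scalerN opprK suq2_daE scalerA.
by rewrite rmorphV /= ?unitfE ?expf_neq0 ?gt_eqF //; [rewrite rmorphXn /= expr2 invfM mulfVK ?qC_neq0|case/andP: hq].
Qed.

Lemma rnorm_star_b v : rnorm (rho (star b) v) = rnorm (rho b v).
Proof.
apply/eqP; rewrite -(eqrXn2 (n := 2)) ?rnorm_ge0 //.
by rewrite !rnorm_sq !rinner_rep -!repM starK b_normal.
Qed.

(** The relation a d = 1 - b b^* as an identity between norms. *)
Lemma rnorm_d v : rnorm (rho d v) ^+ 2 = rnorm v ^+ 2 - rnorm (rho b v) ^+ 2.
Proof.
rewrite -(rnorm_star_b v) !rnorm_sq !rinner_rep star_d -!repM ad_star starK.
by rewrite repD rep1 -scaleN1r repZ scaleN1r rinnerDr rinnerNr.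
Qed.

Lemma rnorm_a v : rnorm (rho a v) ^+ 2 = rnorm v ^+ 2 - q ^- 2 * rnorm (rho b v) ^+ 2.
Proof.
rewrite -(rnorm_star_b v) !rnorm_sq !rinner_rep star_a -!repM da_star starK.
by rewrite repD rep1 -scaleN1r !repZ scaleN1r rinnerDr rinnerNr rinnerZr.
Qed.

Lemma rnorm_d_le v : rnorm (rho d v) <= rnorm v.
Proof.
rewrite -(ler_pXn2r (n := 2)) ?nnegrE ?rnorm_ge0 //.
by rewrite rnorm_d gerBl exprn_ge0 // rnorm_ge0.
Qed.

Lemma rnorm_b_sq_le v : rnorm (rho b v) ^+ 2 <= q ^+ 2 * rnorm v ^+ 2.
Proof.
case/andP: hq => q0 _; have := sqr_ge0 (rnorm (rho a v)).
by rewrite rnorm_a subr_ge0 ler_pdivrMl ?exprn_gt0.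
Qed.

Lemma rnorm_b_le v : rnorm (rho b v) <= rnorm v.
Proof.
rewrite -(ler_pXn2r (n := 2)) ?nnegrE ?rnorm_ge0 //.
apply: le_trans (rnorm_b_sq_le v) _; case/andP: hq => q0 q1.
by rewrite ler_piMl ?exprn_ge0 ?rnorm_ge0 // expr_le1 ?ltW.
Qed.

Lemma rnorm_a_le v : rnorm (rho a v) <= rnorm v.
Proof.
rewrite -(ler_pXn2r (n := 2)) ?nnegrE ?rnorm_ge0 //.
rewrite rnorm_a gerBl mulr_ge0 ?exprn_ge0 ?rnorm_ge0 // invr_ge0 exprn_ge0 //.
by case/andP: hq => /ltW.
Qed.

Lemma rnorm_dX_le m v : rnorm (rho (d ^+ m) v) <= rnorm v.
Proof.
elim: m => [|m IH]; first by rewrite rep1.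
by rewrite exprS repM; apply: le_trans (rnorm_d_le _) IH.
Qed.

Lemma rnorm_bd v : rnorm (rho b (rho d v)) = q * rnorm (rho d (rho b v)).
Proof.
by rewrite -!repM suq2_bdE repZ rnormZ ger0_norm //; case/andP: hq => /ltW.
Qed.

Lemma rnorm_bdX_le m v : rnorm (rho b (rho (d ^+ m) v)) <= q ^+ m * rnorm v.
Proof.
have bdX : b * d ^+ m = (q ^+ m)%:C%C *: (d ^+ m * b).
  elim: m => [|m IH]; first by rewrite mulr1 mul1r scale1r.
  rewrite [d ^+ _]exprS [LHS]mulrA suq2_bdE -scalerAl -[d * b * _]mulrA IH.
  by rewrite -scalerAr scalerA mulrA exprS rmorphM.
have q0 : 0 <= q by case/andP: hq => /ltW.
rewrite -repM bdX repZ repM rnormZ ger0_norm ?exprn_ge0 // ler_wpM2l ?exprn_ge0 //.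
exact: le_trans (rnorm_dX_le _ _) (rnorm_b_le _).
Qed.

(** With U, B, C the square norms of v, b v, b b v, the claim is
B - C <= r (U - B). Cauchy-Schwarz and the normality of b give B^2 <= C U,
hence (B - C) U <= B (U - B) <= r U (U - B). *)
Lemma rnorm_bd_gain v r : rnorm (rho b v) ^+ 2 <= r * rnorm v ^+ 2 ->
  rnorm (rho b (rho d v)) ^+ 2 <= q ^+ 2 * r * rnorm (rho d v) ^+ 2.
Proof.
move=> h; rewrite rnorm_bd exprMn -mulrA ler_wpM2l ?sqr_ge0 // !rnorm_d.
set U := rnorm v ^+ 2 in h *; set B := rnorm (rho b v) ^+ 2 in h *.
set C := rnorm (rho b (rho b v)) ^+ 2.
have UB : B <= U by rewrite -subr_ge0 -rnorm_d sqr_ge0.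
have B0 : 0 <= B by apply: sqr_ge0.
have BC : B ^+ 2 <= C * U.
  rewrite /C /U -exprMn ler_pXn2r ?nnegrE ?sqr_ge0 ?mulr_ge0 ?rnorm_ge0 //.
  rewrite /B rnorm_sq rinner_rep rinnerC -(rnorm_star_b (rho b v)).
  exact: rinner_le.
have C0 : 0 <= C by apply: sqr_ge0.
have [U0|U0] := eqVneq U 0.
  have B00 : B = 0 by apply/eqP; rewrite eq_le B0 -U0 UB.
  by rewrite U0 B00; nra.
have Up : 0 < U by rewrite lt_def U0 sqr_ge0.
rewrite -(ler_pM2r Up); nra.
Qed.

Lemma rnorm_bdX_sq_le m v :
  rnorm (rho b (rho (d ^+ m) v)) ^+ 2 <= q ^+ m.+1 ^+ 2 * rnorm (rho (d ^+ m) v) ^+ 2.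
Proof.
elim: m => [|m IH]; first by rewrite rep1 expr1 rnorm_b_sq_le.
by rewrite [d ^+ _]exprS repM [q ^+ m.+2]exprS exprMn; apply: rnorm_bd_gain.
Qed.

(** Each application of d multiplies the relative size of b by at most q, so that d
becomes almost isometric on its iterates. *)
Lemma rnorm_dX_ge m v :
  (1 - q ^+ m.+1) * rnorm (rho (d ^+ m) v) ^+ 2 <= rnorm (rho (d ^+ m.+1) v) ^+ 2.
Proof.
case/andP: hq => q0 q1; rewrite [d ^+ m.+1]exprS repM rnorm_d mulrBl mul1r lerD2l lerN2.
apply: le_trans (rnorm_bdX_sq_le m v) _; rewrite ler_wpM2r ?sqr_ge0 //.
by rewrite expr2 ler_piMl ?exprn_ge0 ?exprn_ile1 ?ltW.
Qed.

(** One of r and r^-1 is less than 1. Having both saves a distinction of cases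
in the applications. *)
Lemma shrink_eq0 (f : H -> H) (r M : R) : 0 < r -> r != 1 -> 0 <= M ->
  bounded_by P f M ->
  (forall N, 0 <= N -> bounded_by P f N ->
     bounded_by P f (r * N) /\ bounded_by P f (r^-1 * N)) ->
  forall v, good P v -> f v = 0.
Proof.
move=> r0 r1 M0 hM step v gv; apply: rnorm_eq0.
have [t [t0 t1 ht]] : exists t, [/\ 0 <= t, t < 1 & forall N, 0 <= N ->
    bounded_by P f N -> bounded_by P f (t * N)].
  have [rl|rg] := ltP r 1.
    by exists r; split=> [||N N0 /(step N N0)[]] //; apply: ltW.
  exists r^-1; split=> [||N N0 /(step N N0)[]] //; first by rewrite invr_ge0 ltW.
  by rewrite invf_lt1 // lt_def r1.
have ht' n : bounded_by P f (t ^+ n * M).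
  elim: n => [|n IH]; first by rewrite mul1r.
  by rewrite exprS -mulrA; apply: ht => //; rewrite mulr_ge0 ?exprn_ge0.
apply: (geometric_eq0 (r := t) (C := M * rnorm v)).
- by rewrite t0.
- exact: rnorm_ge0.
- by rewrite mulr_ge0 ?rnorm_ge0.
- by move=> n; rewrite mulrAC mulrC [M * _]mulrC mulrC; apply: ht'.
Qed.

Lemma twistedP s (k : R[i]) T T' :
  twisted s T -> twisted s T' -> twisted s (k *: T + T').
Proof.
case=> Ta Tb Tc Td [Ta' Tb' Tc' Td']; split; rewrite linearPl linearPr /=.
- by rewrite Ta Ta' scalerDr !scalerA mulrC.
- by rewrite Tb Tb' scalerDr !scalerA mulrC.
- by rewrite Tc Tc' scalerDr !scalerA mulrC.
- by rewrite Td Td' scalerDr !scalerA mulrC.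
Qed.

Lemma fstar0 : fstar (0 : G) = 0.
Proof.
by have := fstarP (-1) (0 : G) 0; rewrite rmorphN1 scaler0 addr0 scaleN1r addNr.
Qed.

Lemma fstarZ (k : R[i]) T : fstar (k *: T) = k^* *: fstar T.
Proof. by have := fstarP k T 0; rewrite fstar0 !addr0. Qed.

Lemma fstarZr (s : R) T : fstar (s%:C%C *: T) = s%:C%C *: fstar T.
Proof. by rewrite fstarZ [_^*]conjc_real. Qed.

Lemma fstarD T T' : fstar (T + T') = fstar T + fstar T'.
Proof. by rewrite -[T]scale1r fstarP rmorph1 !scale1r. Qed.

(** The relations are exchanged in pairs by the involution, because s is real. *)
Lemma twisted_star s T : s != 0 -> twisted s T -> twisted s (fstar T).
Proof.
have p0 : p != 0 by apply: qC_neq0 hq.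
have pr : (- p) != 0 by rewrite oppr_eq0.
have pr' : - p^-1 != 0 by rewrite oppr_eq0 invr_eq0.
move=> s0; have sC0 : s%:C%C != 0 by rewrite (fmorph_eq0 (real_complex R)).
case=> Ta Tb Tc Td.
have flip x (t : R) : t != 0 -> ract G T x = t%:C%C *: lact G x T ->
    ract G (fstar T) (star x) = t^-1%:C%C *: lact G (star x) (fstar T).
  move=> t0 /(congr1 (@fstar _ _ _)); rewrite fstar_ract fstarZr fstar_lact => ->.
  by rewrite scalerA -rmorphM mulVf // scale1r.
have sV0 : s^-1 != 0 by rewrite invr_eq0.
have := flip _ _ sV0 Ta; have := flip _ _ s0 Tb; have := flip _ _ sV0 Tc.
have := flip _ _ s0 Td; rewrite star_a star_b star_c star_d invrK.
rewrite !linearZr_LR !linearZl_LR /= => Ta' Tb' Tc' Td'; split=> //.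
  by apply: (scalerI pr'); rewrite Tb' !scalerA mulrC.
by apply: (scalerI pr); rewrite Tc' !scalerA mulrC.
Qed.

Hypothesis diff_bounded : forall x, bounded_on (core P) (cval (fdiff G x)).

Lemma rinner_cop T u v : good P u -> good P v ->
  rinner (cop T u) v = rinner u (cop (fstar T) v).
Proof. by move=> gu gv; rewrite /rinner cop_star. Qed.

(** With f = b T, the rule for c, which is proportional to the adjoint of b,
makes g = s^-1 b^* T adjoint to f; as b is normal, f and g have proportional
norms. Bounds pass to adjoints, so a bound N of f yields the bounds |s| N and
N / |s|. Once b T = 0, the operators a and d are isometric on the range of T
and the rules for a and d yield the same pair of bounds for T itself. *)
Lemma twisted_selfadjoint_eq0 s T : s != 0 -> s ^+ 2 != 1 ->
  twisted s T -> fstar T = T -> T = 0.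
Proof.
move=> s0 s1 [Ta Tb Tc Td] sT.
have ns0 : 0 < `|s| by rewrite normr_gt0.
have ns1 : `|s| != 1 by rewrite -sqr_norm_eq1.
have [M M0 hM] := form_bounded diff_bounded T.
have p0 : p != 0 by apply: qC_neq0 hq.
have bT : forall v, good P v -> rho b (cop T v) = 0.
  pose f v := rho b (cop T v); pose g v := (s^-1)%:C%C *: rho (star b) (cop T v).
  have fg u v : good P u -> good P v -> rinner (f u) v = rinner u (g v).
    move=> gu gv; rewrite /f rinner_rep rinner_cop //; last exact: good_rep.
    rewrite sT -cop_ract // star_b linearZr_LR /= Tc.
    by rewrite copZ // copZ // cop_lact // /g star_b repZ !scalerA mulrC.
  have nf v : rnorm (g v) = `|s|^-1 * rnorm (f v).
    by rewrite /g rnormZ rnorm_star_b normfV.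
  apply: (shrink_eq0 ns0 ns1 M0 (f := f)) => [v gv|N N0 hN].
    by apply: le_trans (rnorm_b_le _) _; exact: hM.
  split=> v gv.
    rewrite -mulrA -ler_pdivrMl // -nf.
    apply: (dense_rnorm_le (@good_dense _ _ _ P)) => [|u gu].
      by rewrite mulr_ge0 ?rnorm_ge0.
    rewrite rinnerC -fg //; apply: le_trans (rinner_le _ _) _.
    by rewrite mulrAC ler_wpM2r ?rnorm_ge0 // hN.
  have sN : 0 <= `|s|^-1 * N by rewrite mulr_ge0 ?invr_ge0.
  apply: (dense_rnorm_le (@good_dense _ _ _ P)) => [|u gu].
    by rewrite mulr_ge0 ?rnorm_ge0.
  rewrite fg //; apply: le_trans (rinner_le _ _) _.
  rewrite nf mulrCA -!mulrA ler_wpM2l ?invr_ge0 // [N * _]mulrCA.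
  by rewrite ler_wpM2l ?rnorm_ge0 // hN.
have na v : good P v -> rnorm (rho a (cop T v)) = rnorm (cop T v).
  move=> gv; apply/eqP; rewrite -(eqrXn2 (n := 2)) ?rnorm_ge0 //.
  by rewrite rnorm_a bT // /rnorm normr0 expr0n mulr0 subr0.
have nd v : good P v -> rnorm (rho d (cop T v)) = rnorm (cop T v).
  move=> gv; apply/eqP; rewrite -(eqrXn2 (n := 2)) ?rnorm_ge0 //.
  by rewrite rnorm_d bT // /rnorm normr0 expr0n subr0.
apply: cop_eq0; apply: (shrink_eq0 ns0 ns1 M0 hM) => N N0 hN; split=> v gv.
  rewrite -mulrA -ler_pdivrMl // -na // -normfV -rnormZ -cop_lact // -copZ //.
  rewrite -Ta cop_ract //; apply: le_trans (hN _ (good_rep _ gv)) _.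
  by rewrite ler_wpM2l // rnorm_a_le.
rewrite -mulrA ler_pdivlMl // -nd // -rnormZ -cop_lact // -copZ //.
rewrite -Td cop_ract //; apply: le_trans (hN _ (good_rep _ gv)) _.
by rewrite ler_wpM2l // rnorm_d_le.
Qed.

(** T is a combination of T + T^* and i (T - T^* ), which are symmetric and
twisted by the same factor. *)
Lemma twisted_eq0 s T : s != 0 -> s ^+ 2 != 1 -> twisted s T -> T = 0.
Proof.
move=> s0 s1 tT; have tT' := twisted_star s0 tT.
have e1 : T + fstar T = 0.
  apply: (twisted_selfadjoint_eq0 s0 s1).
    by rewrite -[T in T + _]scale1r; apply: twistedP.
  by rewrite fstarD fstarK addrC.
have e2 : 'i *: T - 'i *: fstar T = 0.
  have t0 : twisted s (0 : G).
    by split; rewrite linear0l linear0r scaler0.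
  apply: (twisted_selfadjoint_eq0 s0 s1).
    rewrite -scaleNr; apply: twistedP => //.
    by rewrite -[_ *: _]addr0; exact: twistedP tT' t0.
  by rewrite -scaleNr fstarD !fstarZ fstarK rmorphN /= conjCi opprK scaleNr addrC.
have /(scalerI (@neq0Ci _)) e3 : 'i *: T = 'i *: fstar T.
  by apply/eqP; rewrite -subr_eq0 e2.
move: e1; rewrite -e3 -mulr2n -scaler_nat => /eqP.
by rewrite scaler_eq0 pnatr_eq0 /= => /eqP.
Qed.

Lemma rinner_norm_le u v : `|rinner u v| <= rnorm u * rnorm v.
Proof.
rewrite ler_norml rinner_le andbT lerNl -rinnerNl -(rnormN u).
exact: rinner_le.
Qed.

(** A nonzero T that commutes with d up to a phase would force Z to be
unbounded: in the irreducible representations by weighted shifts, the matrix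
entries of Z next to the diagonal grow like q^(-m). The proof tests the relation
at d^(m+1) v and d^m w. *)
Lemma quasicentral_eq0 (e k s : R) (T Z : G) : `|e| = 1 -> k != 0 ->
  ract G T d = e%:C%C *: lact G d T ->
  ract G Z b = k%:C%C *: lact G a T + s%:C%C *: lact G b Z -> T = 0.
Proof.
move=> e1 k0 Td Zb; have k0' : 0 < `|k| by rewrite normr_gt0.
have [q0 q1] : 0 < q /\ q < 1 by apply/andP.
have [M M0 hM] := form_bounded diff_bounded Z.
apply: cop_eq0 => v gv; pose x := cop T v; rewrite -/x.
have TdX m : cop T (rho (d ^+ m) v) = (e ^+ m)%:C%C *: rho (d ^+ m) x.
  elim: m => [|m IH]; first by rewrite !rep1 scale1r.
  rewrite [d ^+ _]exprS repM -cop_ract; last exact: good_rep.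
  rewrite Td copZ ?cop_lact; try exact: good_rep.
  by rewrite IH linearZ scalerA -rmorphM [e ^+ m.+1]exprS repM.
pose C := M * (1 + `|s|) / `|k|.
have C0 : 0 <= C by rewrite divr_ge0 ?mulr_ge0 ?addr_ge0.
(* The factor q ^+ m comes from b d^m = q^m d^m b, used once on each side of
   the inner product. *)
have key m w : good P w -> rinner (rho (d ^+ m.+1) x) (rho (d ^+ m.+1) w) <=
    C * q ^+ m * rnorm v * rnorm w.
  move=> gw; pose v' := rho (d ^+ m.+1) v; pose w' := rho (d ^+ m) w.
  have gv' : good P v' by apply: good_rep.
  have := congr1 (fun T => rinner (cop T v') w') Zb.
  rewrite /= cop_ract // copD // !copZ // !cop_lact // TdX !linearZ /= scalerA.
  rewrite rinnerDl -rmorphM !rinnerZl (rinner_rep a) (rinner_rep b) star_a.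
  rewrite (_ : rho d w' = rho (d ^+ m.+1) w); last by rewrite exprS repM.
  move=> E; pose I1 := rinner (cop Z (rho b v')) w'.
  pose I2 := rinner (cop Z v') (rho (star b) w').
  have I1le : `|I1| <= M * (q ^+ m * rnorm v) * rnorm w.
    apply: le_trans (rinner_norm_le _ _) _.
    apply: ler_pM; rewrite ?rnorm_ge0 ?rnorm_dX_le //.
    apply: le_trans (hM _ (good_rep _ gv')) _; rewrite ler_wpM2l //.
    apply: le_trans (rnorm_bdX_le _ _) _; rewrite ler_wpM2r ?rnorm_ge0 //.
    by rewrite exprS ler_piMl ?exprn_ge0 ?ltW.
  have I2le : `|I2| <= M * rnorm v * (q ^+ m * rnorm w).
    apply: le_trans (rinner_norm_le _ _) _.
    apply: ler_pM; rewrite ?rnorm_ge0 //.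
      apply: le_trans (hM _ gv') _; rewrite ler_wpM2l //; exact: rnorm_dX_le.
    by rewrite rnorm_star_b rnorm_bdX_le.
  set I := rinner (rho (d ^+ m.+1) x) _ in E *.
  have EI : `|k| * `|I| = `|I1 - s * I2|.
    by rewrite /I1 /I2 E addrK !normrM normrX e1 expr1n mul1r.
  have : `|I1 - s * I2| <= `|I1| + `|s| * `|I2|.
    by apply: le_trans (ler_normB _ _) _; rewrite normrM.
  rewrite -EI => kI.
  apply: le_trans (ler_norm I) _; rewrite /C.
  rewrite -(ler_pM2l k0'); apply: le_trans kI _.
  rewrite (_ : `|k| * _ = M * (q ^+ m * rnorm v) * rnorm w +
     `|s| * (M * rnorm v * (q ^+ m * rnorm w))); last by field; rewrite gt_eqF.
  by apply: lerD => //; rewrite ler_wpM2l.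
(* The image of T need not consist of good vectors, so w is replaced by T v
   through density. *)
have keyn m : rnorm (rho (d ^+ m.+1) x) ^+ 2 <= C * rnorm v * rnorm x * q ^+ m.
  have Cv : 0 <= C * q ^+ m * rnorm v by rewrite mulr_ge0 ?rnorm_ge0 // mulr_ge0 // exprn_ge0 // ltW.
  rewrite rnorm_sq rinner_rep_star; apply: le_trans (rinner_le _ _) _.
  rewrite [leRHS]mulrAC [C * _ * _]mulrAC ler_wpM2r ?rnorm_ge0 //.
  apply: (dense_rnorm_le (@good_dense _ _ _ P)) => // w gw.
  by rewrite rinner_rep starK key.
have := @slow_decay_eq0 _ q (fun m => rnorm (rho (d ^+ m.+1) x) ^+ 2)
  (C * rnorm v * rnorm x) hq.
rewrite expr1 => dx0; have {}dx0 : rnorm (rho d x) ^+ 2 = 0.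
  apply: dx0 => [|m|m|//]; rewrite ?mulr_ge0 ?rnorm_ge0 ?sqr_ge0 //.
  apply: le_trans (rnorm_dX_ge _ _); rewrite ler_wpM2r ?sqr_ge0 // lerD2l lerN2.
  by rewrite ler_wiXn2l ?ltW.
have := rnorm_dX_ge 0 x; rewrite rep1 !expr1 dx0.
rewrite pmulr_rle0 ?subr_gt0 // => x0; apply: rnorm_eq0; apply/eqP.
by rewrite -sqrf_eq0 eq_le x0 sqr_ge0.
Qed.

End TwistedForms.

(** * Left-invariant forms *)

Section Omega.
Variables (R : realType) (q : R) (hq : 0 < q < 1).
Local Notation A := (suq2 hq).
Local Notation p := (q%:C)%C.
Local Notation a := (suq2_of_gen hq Ga).
Local Notation b := (suq2_of_gen hq Gb).
Local Notation c := (suq2_of_gen hq Gc).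
Local Notation d := (suq2_of_gen hq Gd).
Implicit Types (x y : A) (s t : tensor A A).

HB.instance Definition _ :=
  GRing.isLinear.Build R[i] A A *:%R (@antipode _ _ hq) (@antipode_linear _ _ hq).
HB.instance Definition _ := GRing.isLinear.Build R[i] A (tensor A A) *:%R
  (@comult _ _ hq) (@comult_linear _ _ hq).
HB.instance Definition _ :=
  GRing.isLinear.Build R[i] A R[i] *%R (@counit _ _ hq) (@counit_linear _ _ hq).

Definition antipode_mul : tensor A A -> A := tlift (fun x y : A => antipode x * y).

Lemma antipode_mul_bilinear :
  bilinear_for *:%R *:%R (fun x y : A => antipode x * y).
Proof.
split=> [z k x y|z k x y] /=; first by rewrite linearP mulrDl scalerAl.
by rewrite mulrDr scalerAr.
Qed.
HB.instance Definition _ := GRing.isLinear.Build R[i] (tensor A A) A *:%R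
  antipode_mul (tlift_linear antipode_mul_bilinear).

Lemma antipode_mul_pure x y : antipode_mul (tpure x y) = antipode x * y.
Proof. exact: tlift_pure antipode_mul_bilinear x y. Qed.

(** The antipode axiom for products is proved by induction on both factors of
a pure tensor, which is why the axiom for the first one is kept as a
hypothesis on an arbitrary tensor s. *)
Lemma antipode_mul_tmul s t k :
  antipode_mul s = k%:A -> antipode_mul (tmul s t) = k *: antipode_mul t.
Proof.
move=> hs; elim/tensor_ind: t => [|x y|t t' IH IH'].
- by rewrite tmul0r linear0 scaler0.
- have -> : antipode_mul (tmul s (tpure x y)) = antipode x * antipode_mul s * y.
    elim/tensor_ind: {hs} s => [|x' y'|s s' IH IH'].
    + by rewrite tmul0l linear0 mulr0 mul0r.
    + by rewrite tmul_pure !antipode_mul_pure antipodeM !mulrA.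
    + by rewrite tmulDl !linearD /= IH IH' mulrDr mulrDl.
  by rewrite hs -scalerAr mulr1 -scalerAl antipode_mul_pure.
- by rewrite tmulDr !linearD /= IH IH' ?scalerDr.
Qed.

(** The antipode axiom S(x_(1)) x_(2) = eps(x). *)
Lemma antipodeP x : antipode_mul (comult x) = (counit x)%:A.
Proof.
have p0 : p != 0 by apply: qC_neq0 hq.
elim/suq2_ind: x => [k|g|x y IHx IHy|x y IHx IHy].
- by rewrite !linearZ /= comult1 counit1 antipode_mul_pure antipode1 !mulr1.
- rewrite comultE counitE; case: g; rewrite /= linearD /= !antipode_mul_pure !antipodeE /=.
  all: rewrite -?scalerAl ?(suq2_abE, suq2_acE, suq2_bdE, suq2_cdE, suq2_adE, suq2_daE, esym (suq2_bcE hq)).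
  all: rewrite ?scalerA ?scaleNr ?scale0r ?scale1r ?addrK ?mulNr ?mulVf // ?scale1r ?scaleN1r ?subrr ?addNr //.
  by rewrite addrC addrK.
- by rewrite !linearD /= IHx IHy -scalerDl.
- by rewrite comultM (antipode_mul_tmul _ IHx) IHy scalerA counitM.
Qed.

Section Forms.
Variable G : fodc A.
Local Notation "x *> w" := (lact G x w) (at level 40, left associativity).
Local Notation "w <* x" := (ract G w x) (at level 40, left associativity).
Local Notation W := (omega G).

Definition omega_tensor : tensor A A -> G := tlift (fun x y => antipode x *> fdiff G y).

Lemma omega_tensor_bilinear :
  bilinear_for *:%R *:%R (fun x y => antipode x *> fdiff G y).
Proof.
split=> [z k x y|z k x y] /=; first by rewrite linearP linearPl.
by rewrite linearP linearPr.
Qed.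
HB.instance Definition _ := GRing.isLinear.Build R[i] (tensor A A) G *:%R
  omega_tensor (tlift_linear omega_tensor_bilinear).

Lemma omega_tensor_pure x y : omega_tensor (tpure x y) = antipode x *> fdiff G y.
Proof. exact: tlift_pure omega_tensor_bilinear x y. Qed.

Lemma omega_is_linear : linear W.
Proof.
by move=> k x y; rewrite /omega -/omega_tensor !linearP.
Qed.
HB.instance Definition _ := GRing.isLinear.Build R[i] A G _ W omega_is_linear.

Lemma omegaD x y : W (x + y) = W x + W y. Proof. exact: linearD. Qed.
Lemma omegaB x y : W (x - y) = W x - W y. Proof. exact: linearB. Qed.
Lemma omegaZ k x : W (k *: x) = k *: W x. Proof. exact: linearZ. Qed.

Lemma omegaE x : W x = omega_tensor (comult x). Proof. by []. Qed.

Lemma omega_gen :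
  [/\ W a = d *> fdiff G a - p^-1 *: (b *> fdiff G c),
      W b = d *> fdiff G b - p^-1 *: (b *> fdiff G d),
      W c = - (p *: (c *> fdiff G a)) + a *> fdiff G c &
      W d = - (p *: (c *> fdiff G b)) + a *> fdiff G d].
Proof.
split; rewrite omegaE comultE /= linearD /= !omega_tensor_pure !antipodeE /=.
all: by rewrite linearZl_LR scaleNr.
Qed.

(** From the Leibniz rule, S(x_(1) y_(1)) d(x_(2) y_(2)) =
S(y_(1)) W(x) y_(2) + eps(x) S(y_(1)) d y_(2); here s is the coproduct of the
first factor and x (x) y a summand of that of the second one. *)
Lemma omega_tensorM s x y k : antipode_mul s = k%:A ->
  omega_tensor (tmul s (tpure x y)) =
    antipode x *> omega_tensor s <* y + k *: omega_tensor (tpure x y).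
Proof.
move=> hs.
have -> : k *: omega_tensor (tpure x y) = (antipode x * antipode_mul s) *> fdiff G y.
  by rewrite hs -scalerAr mulr1 linearZl_LR omega_tensor_pure.
elim/tensor_ind: {hs} s => [|x' y'|s s' IH IH'].
- by rewrite tmul0l !linear0 linear0l mulr0 linear0l addr0.
- rewrite tmul_pure !omega_tensor_pure antipode_mul_pure antipodeM fdiffM.
  by rewrite linearDr /= -!lactM -lractA addrC !mulrA.
- rewrite tmulDl !linearD /= IH IH' mulrDr !linearDl /=.
  by rewrite addrACA.
Qed.

Lemma omegaM_gen x :
  [/\ W (x * a) = d *> W x <* a - p^-1 *: (b *> W x <* c) + counit x *: W a,
      W (x * b) = d *> W x <* b - p^-1 *: (b *> W x <* d) + counit x *: W b,
      W (x * c) = - (p *: (c *> W x <* a)) + a *> W x <* c + counit x *: W c &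
      W (x * d) = - (p *: (c *> W x <* b)) + a *> W x <* d + counit x *: W d].
Proof.
have h := omega_tensorM _ _ (antipodeP x).
split; rewrite !omegaE comultM comultE /= tmulDr !linearD /= !h addrACA -scalerDr -omegaE.
all: by rewrite !antipodeE /= ?linearZl_LR ?scaleNr.
Qed.

(** The matrix of generators (a b; c d) is invertible, with the inverse
S(a b; c d) = (d, - q^-1 b; - q c, a). *)
Lemma comult_gen_inverse (X Y : G) :
  a *> (d *> X - p^-1 *: (b *> Y)) + b *> (- (p *: (c *> X)) + a *> Y) = X /\
  c *> (d *> X - p^-1 *: (b *> Y)) + d *> (- (p *: (c *> X)) + a *> Y) = Y.
Proof.
have p0 : p != 0 by apply: qC_neq0 hq.
rewrite !(linearDr, linearNr, linearZr_LR) /= -!lactM.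
rewrite suq2_adE suq2_abE suq2_daE suq2_cdE -suq2_bcE.
rewrite !(linearDl, linearZl_LR) /= !scalerA mulVf // !scale1r !lact1.
split; first by rewrite addrACA addrK addNr addr0.
by rewrite addrACA subrr add0r addrC addrK.
Qed.

(** W(x) y = y_(1) W(x y_(2)) for y one of the generators. *)
Lemma omega_ract x : counit x = 0 ->
  [/\ W x <* a = a *> W (x * a) + b *> W (x * c),
      W x <* b = a *> W (x * b) + b *> W (x * d),
      W x <* c = c *> W (x * a) + d *> W (x * c) &
      W x <* d = c *> W (x * b) + d *> W (x * d)].
Proof.
move=> x0; have [-> -> -> ->] := omegaM_gen x.
rewrite x0 !scale0r !addr0 !lractA.
have [e1 e2] := comult_gen_inverse (W x <* a) (W x <* c).
by have [e3 e4] := comult_gen_inverse (W x <* b) (W x <* d).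
Qed.

(** dy = y_(1) W(y_(2)) for y one of the generators. *)
Lemma fdiff_gen :
  [/\ fdiff G a = a *> W a + b *> W c, fdiff G b = a *> W b + b *> W d,
      fdiff G c = c *> W a + d *> W c & fdiff G d = c *> W b + d *> W d].
Proof.
have [-> -> -> ->] := omega_gen.
have [e1 e2] := comult_gen_inverse (fdiff G a) (fdiff G c).
by have [e3 e4] := comult_gen_inverse (fdiff G b) (fdiff G d).
Qed.

Lemma fdiff1 : fdiff G 1 = 0.
Proof.
have := @fdiffM _ _ G 1 1; rewrite mulr1 lact1 ract1 => e.
by apply: (addrI (fdiff G 1)); rewrite addr0 -e.
Qed.

Lemma omega1 : W 1 = 0.
Proof. by rewrite omegaE comult1 omega_tensor_pure fdiff1 linear0r. Qed.

Lemma fdiff_eq0 : W a = 0 -> W b = 0 -> W c = 0 -> W d = 0 -> forall x, fdiff G x = 0.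
Proof.
move=> a0 b0 c0 d0; have := fdiff_gen; rewrite a0 b0 c0 d0 !linear0r !addr0.
move=> [da0 db0 dc0 dd0]; elim/suq2_ind => [k|g|x y IHx IHy|x y IHx IHy].
- by rewrite linearZ /= fdiff1 scaler0.
- by case: g.
- by rewrite linearD /= IHx IHy addr0.
- by rewrite fdiffM IHx IHy linear0r linear0l addr0.
Qed.

End Forms.

Lemma omega_hom (G1 G2 : star_fodc A) (f : {linear G1 -> G2}) x :
  star_fodc_hom f -> f (omega G1 x) = omega G2 x.
Proof.
case=> hf _; rewrite !omegaE; elim/tensor_ind: (comult x) => [|u v|s t IHs IHt].
- by rewrite !linear0.
- rewrite /omega_tensor !(tlift_pure (omega_tensor_bilinear _)).
  by have := hf (antipode u) v 1; rewrite /fform !ract1.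
- by rewrite !linearD /= IHs IHt.
Qed.

End Omega.

(** * The ideals of the 3D- and 4D-calculi *)

Section Calculi.
Variables (R : realType) (q : R) (hq : 0 < q < 1) (G : fodc (suq2 hq)).
Local Notation A := (suq2 hq).
Local Notation p := (q%:C)%C.
Local Notation a := (suq2_of_gen hq Ga).
Local Notation b := (suq2_of_gen hq Gb).
Local Notation c := (suq2_of_gen hq Gc).
Local Notation d := (suq2_of_gen hq Gd).
Local Notation "x *> w" := (lact G x w) (at level 40, left associativity).
Local Notation "w <* x" := (ract G w x) (at level 40, left associativity).
Local Notation W := (omega G).

Lemma omega_twisted s x : counit x = 0 ->
  W (x * a) = (s^-1)%:C%C *: W x -> W (x * b) = 0 -> W (x * c) = 0 ->
  W (x * d) = s%:C%C *: W x -> twisted s (W x).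
Proof.
move=> x0 xa xb xc xd; have [ea eb ec ed] := omega_ract G x0.
split; rewrite ?ea ?eb ?ec ?ed ?xa ?xb ?xc ?xd !linear0r ?addr0 ?add0r.
all: by rewrite linearZr_LR.
Qed.

Lemma scaler_solve (k l : R[i]) (u v : G) : k != 0 -> k *: u = l *: v -> u = (k^-1 * l) *: v.
Proof. by move=> k0 e; rewrite -scalerA -e scalerA mulVf // scale1r. Qed.

Let q0 : q != 0. Proof. by case/andP: hq => /lt0r_neq0. Qed.
Let p0 : p != 0. Proof. exact: qC_neq0 hq. Qed.

Lemma counit_gens : [/\ counit a = 1, counit b = 0, counit c = 0 & counit d = 1].
Proof. by rewrite !counitE. Qed.

Let dbE : d * b = p^-1 *: (b * d).
Proof. by rewrite suq2_bdE scalerA mulVf // scale1r. Qed.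
Let dcE : d * c = p^-1 *: (c * d).
Proof. by rewrite suq2_cdE scalerA mulVf // scale1r. Qed.

(** The algebra is carried out in an arbitrary calculus in which the analytic
facts above hold. *)
Hypothesis twist_eq0 : forall (s : R) (T : G),
  s != 0 -> s ^+ 2 != 1 -> twisted s T -> T = 0.

Lemma fdiff_eq0_3D : (forall r x, gens_3D (hq := hq) r -> W (r * x) = 0) ->
  forall x, fdiff G x = 0.
Proof.
move=> h; have [ca cb cc cd] := counit_gens; case/andP: (hq) => qp q1.
have h1 r : gens_3D (hq := hq) r -> W r = 0 by move=> Sr; rewrite -[r]mulr1 h.
have gb2 : gens_3D (hq := hq) (b ^+ 2) by rewrite /gens_3D /= !inE eqxx.
have gc2 : gens_3D (hq := hq) (c ^+ 2) by rewrite /gens_3D /= !inE eqxx ?orbT.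
have gbc : gens_3D (hq := hq) (b * c) by rewrite /gens_3D /= !inE eqxx ?orbT.
have gab : gens_3D (hq := hq) ((a - 1) * b) by rewrite /gens_3D /= !inE eqxx ?orbT.
have gac : gens_3D (hq := hq) ((a - 1) * c) by rewrite /gens_3D /= !inE eqxx ?orbT.
(* The q-trace minus its counit. Its vanishing determines W (d * x) in terms of
   W (a * x). *)
pose t : A := p ^+ 2 *: a + d - (p ^+ 2 + 1)%:A.
have gt : gens_3D (hq := hq) t by rewrite /gens_3D /= !inE eqxx ?orbT.
have Wt x : p ^+ 2 *: W (a * x) + W (d * x) - (p ^+ 2 *: W x + W x) = 0.
  have := h _ x gt; rewrite /t mulrBl mulrDl mulr_algl -scalerAl.
  by rewrite omegaB omegaD !omegaZ scalerDl scale1r.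
have tw x : counit x = 0 -> W (a * x) = W x -> a * x = p *: (x * a) ->
    d * x = p^-1 *: (x * d) -> W (x * b) = 0 -> W (x * c) = 0 -> W x = 0.
  move=> x0 ax axE dxE xb xc.
  have xa : W (x * a) = (q^-1)%:C%C *: W x.
    rewrite fmorphV -ax axE omegaZ scalerA mulVf // scale1r //.
  have xd : W (x * d) = p *: W x.
    have := Wt x; rewrite ax dxE omegaZ opprD addrA.
    rewrite [p ^+ 2 *: _ + _]addrC addrK => /eqP; rewrite subr_eq0 => /eqP <-.
    by rewrite scalerA divff // scale1r.
  apply: (twist_eq0 q0); last exact: omega_twisted.
  by rewrite lt_eqF // expr_lt1 // ltW.
have Wbc : W (b * c) = 0 by apply: h1.
have b0 : W b = 0.
  apply: tw => //; last by rewrite -expr2; apply: h1.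
  - by have := h1 _ gab; rewrite mulrBl mul1r omegaB => /eqP; rewrite subr_eq0 => /eqP.
  - exact: suq2_abE.
have c0 : W c = 0.
  apply: tw => //; last by rewrite -expr2; apply: h1.
  - by have := h1 _ gac; rewrite mulrBl mul1r omegaB => /eqP; rewrite subr_eq0 => /eqP.
  - exact: suq2_acE.
  - by rewrite -suq2_bcE.
have W1 : W 1 = 0 by apply: omega1.
have Wd : W d = - (p ^+ 2 *: W a).
  have := h1 _ gt; rewrite /t omegaB omegaD !omegaZ W1 scaler0 subr0.
  by move/eqP; rewrite addrC addr_eq0 => /eqP.
have Wad : W (a * d) = 0 by rewrite suq2_adE omegaD omegaZ W1 Wbc scaler0 addr0.
have Wda : W (d * a) = 0 by rewrite suq2_daE omegaD omegaZ W1 Wbc scaler0 addr0.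
have a0 : W a = 0.
  have -> : W a = W (a - 1) by rewrite omegaB W1 subr0.
  have p20 : p ^+ 2 != 0 by rewrite expf_neq0.
  apply: (twist_eq0 (s := q ^+ 2)).
  - by rewrite expf_neq0.
  - by rewrite -exprM lt_eqF // exprn_ilt1 // ltW.
  apply: omega_twisted.
  - by rewrite linearB /= counit1 ca subrr.
  - rewrite fmorphV rmorphXn /= mulrBl mul1r !omegaB W1 subr0.
    have := Wt a; rewrite Wda addr0 opprD addrA -scalerBr => /eqP.
    rewrite subr_eq0 => /eqP e; apply: (scalerI p20).
    by rewrite e scalerA divff // scale1r.
  - exact: h1.
  - exact: h1.
  - by rewrite rmorphXn /= mulrBl mul1r !omegaB Wad W1 subr0 Wd sub0r opprK.
by apply: fdiff_eq0; rewrite // Wd a0 scaler0 oppr0.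
Qed.


Hypothesis quasicentral_b : forall (e k s : R) (T Z : G), e ^+ 2 = 1 -> k != 0 ->
  twisted e T -> Z <* b = k%:C%C *: (a *> T) + s%:C%C *: (b *> Z) -> T = 0.
Hypothesis quasicentral_c : forall (e k s : R) (T Z : G), e ^+ 2 = 1 -> k != 0 ->
  s != 0 -> twisted e T ->
  Z <* c = s%:C%C *: (c *> Z) + k%:C%C *: (d *> T) -> T = 0.

(** For eps = 1 all terms are positive; for eps = -1 the sum is
- q^-1 (1 - q) (1 - q^3). *)
Lemma trace_gap_neq0 (eps : R) : eps ^+ 2 = 1 ->
  eps * (q ^+ 3 + q^-1) + (q ^+ 2 + 1) != 0.
Proof.
case/andP: (hq) => qp q1 /eqP; rewrite sqrf_eq1 => /orP[] /eqP ->.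
  by rewrite gt_eqF // mul1r !addr_gt0 // ?invr_gt0 ?exprn_gt0.
rewrite (_ : _ + _ = - (q^-1 * ((1 - q) * (1 - q ^+ 3)))); last by field.
rewrite oppr_eq0 !mulf_neq0 ?invr_eq0 // subr_eq0 eq_sym lt_eqF //.
by rewrite exprn_ilt1 // ltW.
Qed.

Lemma fdiff_eq0_4D (eps : R) : eps ^+ 2 = 1 ->
  (forall r x, gens_4D (hq := hq) eps r -> W (r * x) = 0) -> forall x, fdiff G x = 0.
Proof.
move=> e1 h; have [ca cb cc cd] := counit_gens; case/andP: (hq) => qp q1.
have en0 : eps != 0 by rewrite -sqrf_eq0 e1 oner_eq0.
pose e : R[i] := eps%:C%C.
have nz (t : R) : t != 0 -> t%:C%C != 0 by rewrite (fmorph_eq0 (real_complex R)).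
have e0 : e != 0 by apply: nz.
have eV : e^-1 = e.
  by apply: (mulfI e0); rewrite divff // -rmorphM -expr2 e1 rmorph1.
have epsV : eps^-1 = eps by apply: (mulfI en0); rewrite divff // -expr2 e1.
have h1 r : gens_4D (hq := hq) eps r -> W r = 0 by move=> Sr; rewrite -[r]mulr1 h.
have g1 : gens_4D (hq := hq) eps (b ^+ 2) by rewrite /gens_4D /= !inE eqxx.
have g2 : gens_4D (hq := hq) eps (c ^+ 2) by rewrite /gens_4D /= !inE eqxx ?orbT.
have g3 : gens_4D (hq := hq) eps (b * (a - d)) by rewrite /gens_4D /= !inE eqxx ?orbT.
have g4 : gens_4D (hq := hq) eps (c * (a - d)) by rewrite /gens_4D /= !inE eqxx ?orbT.
pose Q : A := a ^+ 2 + p ^+ 2 *: d ^+ 2 - (1 + p ^+ 2) *: (a * d + p^-1 *: (b * c)).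
have g5 : gens_4D (hq := hq) eps Q by rewrite /gens_4D /= !inE eqxx ?orbT.
pose z := z_4D hq eps.
have g6 : gens_4D (hq := hq) eps (z * b) by rewrite /gens_4D /= !inE eqxx ?orbT.
have g7 : gens_4D (hq := hq) eps (z * c) by rewrite /gens_4D /= !inE eqxx ?orbT.
have g8 : gens_4D (hq := hq) eps (z * (a - d)) by rewrite /gens_4D /= !inE eqxx ?orbT.
have g9 : gens_4D (hq := hq) eps (z * (p ^+ 2 *: a + d - (p ^+ 2 + 1)%:A)).
  by rewrite /gens_4D /= !inE eqxx ?orbT.
(* Each relation W (z * x) = 0 fixes the value of the q-trace on x. *)
pose K := p ^+ 3 + p^-1.
have Wz x : W (z * x) = 0 -> p ^+ 2 *: W (a * x) + W (d * x) = (e * K) *: W x.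
  rewrite /z /z_4D mulrBl mulrDl mulr_algl -scalerAl omegaB omegaD !omegaZ.
  by move/eqP; rewrite subr_eq0 => /eqP.
have W1 : W 1 = 0 by apply: omega1.
have p41 : p ^+ 4 + 1 != 0.
  rewrite -rmorphXn -[1](rmorph1 (real_complex R)) -rmorphD; apply: nz.
  by rewrite gt_eqF // addr_gt0 ?exprn_gt0.
have Wbb x : W (b * b * x) = 0 by rewrite -expr2 h.
have Wcc x : W (c * c * x) = 0 by rewrite -expr2 h.
(* W (b * c) is twisted: the two relations between the products of b * c with a
   and with d determine both. *)
have Wbc : W (b * c) = 0.
  have hX : p *: W (b * c * a) = p^-1 *: W (b * c * d).
    have := h _ c g3; rewrite mulrBr mulrBl omegaB => /eqP; rewrite subr_eq0.
    rewrite -!mulrA suq2_acE dcE -!scalerAr !omegaZ !mulrA => /eqP //.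
  have Y : W (b * c * d) = p ^+ 2 *: W (b * c * a).
    have := scaler_solve _ (esym hX); rewrite invr_eq0 invrK expr2; exact.
  have hz : (p ^+ 4 + 1) *: W (b * c * a) = (e * K) *: W (b * c).
    have <- := Wz (b * c); last by rewrite mulrA h.
    rewrite (mulrA a) suq2_abE -scalerAl -(mulrA b a) suq2_acE -scalerAr scalerA (mulrA b c).
    rewrite (mulrA d) dbE -scalerAl -(mulrA b d) dcE -scalerAr scalerA (mulrA b c).
    rewrite !omegaZ Y !scalerA -scalerDl; congr (_ *: _); field; exact: p0.
  have X := scaler_solve p41 hz.
  apply: (twist_eq0 (s := eps * q)).
  - by rewrite mulf_neq0.
  - by rewrite exprMn e1 mul1r lt_eqF // expr_lt1 // ltW.
  apply: omega_twisted.
  - by rewrite counitM cb mul0r.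
  - rewrite X; congr (_ *: _); rewrite fmorphV rmorphM /= -/e invfM eV /K; field.
    by apply/andP.
  - by rewrite -mulrA -suq2_bcE mulrA Wbb.
  - by rewrite suq2_bcE -mulrA suq2_bcE mulrA Wcc.
  - rewrite Y X !scalerA; congr (_ *: _); rewrite rmorphM /= -/e /K; field.
    by apply/andP.
(* Common to x = b and x = c: a and d act alike on them, by the sign eps. *)
have tw x : counit x = 0 -> W (x * (a - d)) = 0 -> W (z * x) = 0 ->
    a * x = p *: (x * a) -> d * x = p^-1 *: (x * d) ->
    W (x * b) = 0 -> W (x * c) = 0 ->
    [/\ W (x * a) = e *: W x, W (x * d) = e *: W x & twisted eps (W x)].
  move=> x0 xad zx axE dxE xb xc.
  have ad : W (x * d) = W (x * a).
    by move: xad; rewrite mulrBr omegaB => /eqP; rewrite subr_eq0 => /eqP.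
  have xa : W (x * a) = e *: W x.
    have := Wz x zx; rewrite axE dxE !omegaZ ad scalerA -scalerDl -exprSr -/K.
    have K0 : K != 0.
      rewrite /K -rmorphXn -fmorphV -rmorphD; apply: nz.
      by rewrite gt_eqF // addr_gt0 ?exprn_gt0 ?invr_gt0.
    move/(scaler_solve K0) ->; congr (_ *: _); rewrite mulrCA mulVf // mulr1 //.
  split=> //; first by rewrite ad.
  by apply: omega_twisted; rewrite // ?ad xa // epsV.
have [Wba Wbd tb] : [/\ W (b * a) = e *: W b, W (b * d) = e *: W b & twisted eps (W b)].
  apply: tw => //; [exact: h1|exact: h1|exact: suq2_abE|].
  by rewrite -[b * b]mulr1.
have [Wca Wcd tc] : [/\ W (c * a) = e *: W c, W (c * d) = e *: W c & twisted eps (W c)].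
  apply: tw => //; [exact: h1|exact: h1|exact: suq2_acE|by rewrite -suq2_bcE|].
  by rewrite -[c * c]mulr1.
have Wad : W (a * d) = 0 by rewrite suq2_adE omegaD omegaZ W1 Wbc scaler0 addr0.
have Wda : W (d * a) = 0 by rewrite suq2_daE omegaD omegaZ W1 Wbc scaler0 addr0.
(* Z is almost twisted by (eps * q)^-1; the defects in its rules for b and c
   are k W b and k W c. *)
pose Z := W (a - d); pose k := eps * (q - q^-1).
have kE : k%:C%C = e * (p - p^-1) by rewrite /k rmorphM rmorphB fmorphV.
have k0 : k != 0.
  rewrite mulf_neq0 // subr_eq0 -(inj_eq (mulfI q0)) divff // -expr2.
  by rewrite lt_eqF // expr_lt1 // ltW.
have Zb : W ((a - d) * b) = k%:C%C *: W b.
  rewrite mulrBl omegaB suq2_abE dbE !omegaZ Wba Wbd !scalerA -scalerBl kE.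
  by rewrite -mulrBl mulrC.
have Zc : W ((a - d) * c) = k%:C%C *: W c.
  rewrite mulrBl omegaB suq2_acE dcE !omegaZ Wca Wcd !scalerA -scalerBl kE.
  by rewrite -mulrBl mulrC.
have Waa : W (a * a) = - (p ^+ 2 *: W (d * d)).
  have := h1 _ g5; rewrite /Q !expr2 omegaB omegaD !omegaZ omegaD omegaZ Wad Wbc.
  by rewrite scaler0 addr0 scaler0 subr0 => /eqP; rewrite addr_eq0 => /eqP.
have ZE : Z = W a - W d by apply: omegaB.
have Wdd : W (d * d) = - ((e * p)^-1 *: Z).
  have := Wz _ (h1 _ g8); rewrite !mulrBr !omegaB Wad Wda subr0 sub0r Waa -ZE.
  rewrite scalerN -opprD scalerA -[X in _ + X]scale1r -scalerDl -exprD => E.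
  apply: oppr_inj; rewrite opprK; apply: (scalerI p41).
  rewrite scalerN E scalerA; congr (_ *: _); rewrite invfM eV /K; field.
  exact: p0.
have Zd : W ((a - d) * d) = ((eps * q)^-1)%:C%C *: Z.
  by rewrite mulrBl omegaB Wad sub0r Wdd opprK fmorphV rmorphM.
have Za : W ((a - d) * a) = (eps * q)%:C%C *: Z.
  rewrite mulrBl omegaB Wda subr0 Waa Wdd scalerN opprK scalerA; congr (_ *: _).
  by rewrite rmorphM /= -/e invfM eV; field.
have Zx0 : counit (a - d) = 0 by rewrite linearB /= ca cd subrr.
have [rZa rZb rZc rZd] := omega_ract G Zx0.
have b0 : W b = 0.
  apply: (quasicentral_b e1 k0 tb (Z := Z) (s := (eps * q)^-1)).
  by rewrite rZb Zb Zd !linearZr_LR.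
have c0 : W c = 0.
  apply: (quasicentral_c e1 k0 _ tc (Z := Z) (s := eps * q)); first by rewrite mulf_neq0.
  by rewrite rZc Za Zc !linearZr_LR.
have Z0 : Z = 0.
  apply: (twist_eq0 (s := (eps * q)^-1)).
  - by rewrite invr_eq0 mulf_neq0.
  - by rewrite exprVn invr_eq1 exprMn e1 mul1r lt_eqF // expr_lt1 // ltW.
  apply: omega_twisted; rewrite ?invrK //.
  - by rewrite Zb b0 scaler0.
  - by rewrite Zc c0 scaler0.
have da : W d = W a.
  by move: Z0; rewrite /Z omegaB => /eqP; rewrite subr_eq0 => /eqP.
have a0 : W a = 0.
  have Wdd0 : W (d * d) = 0 by rewrite Wdd Z0 scaler0 oppr0.
  have Waa0 : W (a * a) = 0 by rewrite Waa Wdd0 scaler0 oppr0.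
  have := Wz _ (h1 _ g9).
  rewrite !mulrBr !mulrDr !mulr_algr -!scalerAr !(omegaB, omegaD, omegaZ).
  rewrite Waa0 Wad Wda Wdd0 W1 da !scaler0 !addr0 subr0 !sub0r.
  rewrite scalerN scalerA -opprD -scalerDl -[X in _ *: (_ + X)]scale1r -scalerDl scalerA.
  move=> /eqP; rewrite eq_sym -subr_eq0 opprK -scalerDl scaler_eq0.
  rewrite (_ : _ + _ = ((eps * (q ^+ 3 + q^-1) + (q ^+ 2 + 1)) * (q ^+ 2 + 1))%:C%C); last first.
    rewrite !(rmorphM, rmorphD, rmorphXn, fmorphV, rmorph1) /= -/e; ring.
  have q21 : q ^+ 2 + 1 != 0 by rewrite gt_eqF // addr_gt0 ?exprn_gt0.
  by rewrite (negPf (nz _ (mulf_neq0 (trace_gap_neq0 e1) q21))) => /eqP.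
by apply: fdiff_eq0; rewrite // da.
Qed.

End Calculi.

(** * Bounded commutator representations *)

Section Conclusion.
Variables (R : realType) (q : R) (hq : 0 < q < 1) (H : hilbertType R).
Variable P : comm_pair (suq2 hq) H.
Local Notation A := (suq2 hq).
Local Notation G := (comm_calculus P).
Local Notation p := (q%:C)%C.
Local Notation a := (suq2_of_gen hq Ga).
Local Notation b := (suq2_of_gen hq Gb).
Local Notation c := (suq2_of_gen hq Gc).
Local Notation d := (suq2_of_gen hq Gd).
Local Notation "x *> w" := (lact G x w) (at level 40, left associativity).
Local Notation "w <* x" := (ract G w x) (at level 40, left associativity).
Local Notation W := (omega G).

(** The ideal is known for the abstract calculus only, but a homomorphism maps
its invariant forms to those of the commutator calculus. *)
Lemma rep_omega_eq0 (G0 : star_fodc A) (S : set A) :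
  commutator_rep G0 P -> fodc_ideal G0 = right_ideal_gen S ->
  forall r x, S r -> W (r * x) = 0.
Proof.
case=> f hf hI r x Sr; rewrite -(omega_hom _ hf).
have [_ ->] : fodc_ideal G0 (r * x); last exact: linear0.
by rewrite hI => I [[_ _ hM] SI]; apply/hM/SI.
Qed.

Hypothesis diff_bounded : forall x, bounded_on (core P) (cval (fdiff G x)).

(** The adjoint of a relation of Z with c is a relation of the adjoint of Z with
b, of the form already excluded. *)
Lemma quasicentral_star_eq0 (e k s : R) (T Z : G) : e ^+ 2 = 1 -> k != 0 ->
  s != 0 -> twisted e T ->
  Z <* c = s%:C%C *: (c *> Z) + k%:C%C *: (d *> T) -> T = 0.
Proof.
move=> e1 k0 s0 tT Zc; have e0 : e != 0 by rewrite -sqrf_eq0 e1 oner_eq0.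
have [Ta Tb Tc Td] := twisted_star e0 tT.
have p0 : p != 0 by apply: qC_neq0 hq.
have q0 : q != 0 by case/andP: hq => /lt0r_neq0.
have sC0 : s%:C%C != 0 by rewrite (fmorph_eq0 (real_complex R)).
have T0 : fstar T = 0.
  apply: (quasicentral_eq0 diff_bounded (e := e)
    (k := q * s^-1 * k * e^-1) (s := s^-1) (Z := fstar Z) _ _ Td).
  - by apply/eqP; rewrite -sqr_norm_eq1 e1.
  - by rewrite !mulf_neq0 ?invr_eq0.
  have := congr1 (@fstar _ _ _) Zc.
  rewrite fstarD !fstarZr !fstar_lact fstar_ract star_c star_d.
  rewrite linearZl_LR linearZr_LR /= Ta => E.
  have p1 : s%:C%C^-1 * - p * s%:C%C * - p^-1 = 1 by field; apply/andP.
  rewrite -[LHS]scale1r -p1 -!scalerA.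
  have -> : s%:C%C *: (- p^-1 *: (fstar Z <* b)) =
      - p^-1 *: (b *> fstar Z) - k%:C%C *: ((e^-1)%:C%C *: (a *> fstar T)).
    by rewrite E addrK.
  rewrite !scalerBr !scalerA addrC -scaleNr !rmorphM !fmorphV /=.
  have eC0 : e%:C%C != 0 by rewrite (fmorph_eq0 (real_complex R)).
  by congr (_ *: _ + _ *: _); field; rewrite ?eC0 ?sC0 ?p0.
by rewrite -[T]fstarK T0 fstar0.
Qed.

End Conclusion.

Theorem theorem3 (R : realType) (q : R) (hq : 0 < q < 1) (H : hilbertType R)
    (G : star_fodc (suq2 hq))
    (hG : [\/ is_3D_calculus G, is_4D_calculus 1 G | is_4D_calculus (-1) G])
    (P : comm_pair (suq2 hq) H)
    (hP : commutator_rep G P)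
    (hbounded : forall x : suq2 hq,
      bounded_on (core P) (cval (fdiff (comm_calculus P) x))) :
  forall x : suq2 hq, fdiff (comm_calculus P) x = 0.
Proof.
have tw := twisted_eq0 hbounded.
have hb (e k s : R) (T Z : comm_calculus P) : e ^+ 2 = 1 -> k != 0 -> twisted e T ->
    ract _ Z (suq2_of_gen hq Gb) = k%:C%C *: lact _ (suq2_of_gen hq Ga) T +
      s%:C%C *: lact _ (suq2_of_gen hq Gb) Z -> T = 0.
  move=> e1 k0 [_ _ _ Td]; apply: (quasicentral_eq0 hbounded _ k0 Td).
  by apply/eqP; rewrite -sqr_norm_eq1 e1.
have hc := quasicentral_star_eq0 hbounded.
case: hG => [[_ hI]|[_ hI]|[_ hI]].
- exact: fdiff_eq0_3D tw (rep_omega_eq0 hP hI).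
- exact: (fdiff_eq0_4D tw hb hc (expr1n R 2) (rep_omega_eq0 hP hI)).
- have N1 : (-1) ^+ 2 = 1 :> R by rewrite sqrrN expr1n.
  exact: (fdiff_eq0_4D tw hb hc N1 (rep_omega_eq0 hP hI)).
Qed.
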